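(* Let $u_{0,h}\in V_h$ be the elliptic projection of $u_0$, let $u_{1,h}\in V_h$ be the $L^2(\Omega)$-orthogonal projection of $u_1$ onto $V_h$, and let $U_h\in X_h$ be the solution of the $\mathcal C^0$-in-time method (stated in the context) with source term $f$. Let $m=m(U_h)\in\{1,\dots,N\}$ be an index with $$\|U_h'\|_{L^\infty(I_m;L^2(\Omega))}^2+|U_h|_{L^\infty(I_m;H^1(\Omega))}^2=\max_{n=1,\dots,N}\Big(\|U_h'\|_{L^\infty(I_n;L^2(\Omega))}^2+|U_h|_{L^\infty(I_n;H^1(\Omega))}^2\Big),$$ and let $\mu_m:=\dfrac{1}{1024\,(p_m^t)^2(2p_m^t+1)}$. Then $$\mu_m\Big(\|U_h'\|_{L^\infty(I_m;L^2(\Omega))}^2+|U_h|_{L^\infty(I_m;H^1(\Omega))}^2\Big)+\frac14\sum_{n=1}^m\big\|[\![U_h']\!](t_{n-1},\cdot)\big\|_{0,\Omega}^2\le\frac12\Big(|u_0|_{1,\Omega}^2+\|u_1\|_{0,\Omega}^2\Big)+\frac{t_m}{\mu_m}\|f\|_{L^2(0,t_m;L^2(\Omega))}^2 .$$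
   Context: Setting. $\Omega\subset\mathbb R^d$, $d\in\{1,2,3\}$, is a polytopic Lipschitz domain; $T>0$; $u_0\in H^1_0(\Omega)$, $u_1\in L^2(\Omega)$, $f\in L^2(0,T;L^2(\Omega))$ are the data of the wave equation $u''-\Delta_{\mathbf x}u=f$ in $(0,T]\times\Omega$, $u=0$ on $(0,T]\times\partial\Omega$, $u(0,\cdot)=u_0$, $u'(0,\cdot)=u_1$. Primes are time derivatives; $(\cdot,\cdot)_{0,\Omega}$, $\|\cdot\|_{0,\Omega}$ are the $L^2(\Omega)$ inner product and norm; $|v|_{1,\Omega}=\|\nabla_{\mathbf x}v\|_{0,\Omega}$; $|v|_{L^\infty(I;H^1(\Omega))}=\operatorname{ess\,sup}_{t\in I}|v(t,\cdot)|_{1,\Omega}$; $a(u,v):=(\nabla_{\mathbf x}u,\nabla_{\mathbf x}v)_{0,\Omega}$. Space discretization. $\mathcal T_h$ is a simplicial or tensor-product conforming mesh of $\Omega$ with maximal element diameter $h$; there is $\gamma\in(0,1)$ such that each element is star-shaped with respect to a ball of radius at least $\gamma$ times its diameter, and the diameters $h_1\le h_2$ of any two neighbouring elements satisfy $\gamma h_2\le h_1$. $V_h\subset H^1_0(\Omega)$ is the corresponding Lagrangian finite element space of uniform order $p_{\mathbf x}$. The elliptic projector $\Pi_h^{\mathcal E}:H^1_0(\Omega)\to V_h$ is defined by $a(v-\Pi_h^{\mathcal E}v,v_h)=0$ for all $v_h\in V_h$; the elliptic projection of $u_0$ is $\Pi^{\mathcal E}_hu_0$. Time discretization. $0=t_0<t_1<\dots<t_N=T$,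 $I_n:=(t_{n-1},t_n]$, $\tau_n:=t_n-t_{n-1}$; to each $I_n$ is associated a polynomial degree $p_n^t\ge2$. $\mathbb P_q(I_n;V_h)$ is the space of polynomials in time of degree at most $q$ on $I_n$ with values in $V_h$. Set $$X_h:=\{W\in\mathcal C^0(0,T;V_h):\ W(0,\cdot)=u_{0,h},\ W_{|I_n}\in\mathbb P_{p_n^t}(I_n;V_h)\ \forall n=1,\dots,N\}.$$ The jump is $[\![U_h']\!](t_{n-1},\cdot)=U_h'{}_{|I_n}(t_{n-1},\cdot)-U_h'{}_{|I_{n-1}}(t_{n-1},\cdot)$ for $n\ge2$ and $[\![U_h']\!](0,\cdot)=U_h'{}_{|I_1}(0,\cdot)-u_{1,h}$. $\mathcal C^0$-in-time method: find $U_h\in X_h$ such that, for all $n=1,\dots,N$ and all $W_h\in\mathbb P_{p_n^t-1}(I_n;V_h)$, $$\int_{I_n}\big[(U_h'',W_h)_{0,\Omega}+a(U_h,W_h)\big]dt+\big([\![U_h']\!](t_{n-1},\cdot),W_h^+(t_{n-1},\cdot)\big)_{0,\Omega}=(f,W_h)_{L^2(I_n;L^2(\Omega))},$$ where $W_h^+(t_{n-1},\cdot)$ is the value at $t_{n-1}$ of $W_{h|I_n}$. *)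

(* Defs.v *)
From HB Require Import structures.
From mathcomp Require Import all_boot all_order all_algebra.
From mathcomp Require Import all_classical all_reals all_analysis ess_sup_inf.

Set Implicit Arguments.
Unset Strict Implicit.
Unset Printing Implicit Defensive.
Import Order.TTheory GRing.Theory Num.Theory.
Import numFieldNormedType.Exports.

Local Open Scope classical_set_scope.
Local Open Scope ring_scope.

Definition rV_display : measure_display -> measure_display.
Proof. exact. Qed.

Section measurable_rV.
Context {R : realType} (d : nat).

Let coors : 'I_d -> 'rV[R]_d -> R := fun i x => x ord0 i.

Let rV_set0 : g_sigma_preimage coors set0.
Proof. exact: sigma_algebra0. Qed.

Let rV_setC A : g_sigma_preimage coors A -> g_sigma_preimage coors (~` A).
Proof. exact: sigma_algebraC. Qed.

Let rV_bigcup (F : _^nat) : (forall i, g_sigma_preimage coors (F i)) ->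
  g_sigma_preimage coors (\bigcup_i (F i)).
Proof. exact: sigma_algebra_bigcup. Qed.

(* The sigma-algebra generated by the coordinates, i.e. the Borel sets. *)
HB.instance Definition _ :=
  @isMeasurable.Build (rV_display default_measure_display)
  'rV[R]_d (g_sigma_preimage coors) rV_set0 rV_setC rV_bigcup.

End measurable_rV.

Section lebesgue_measure_rV.
Context {R : realType}.

Lemma measurable_fun_rVP d (T : measurableType d) n (f : T -> 'rV[R]_n) :
  measurable_fun [set: T] f <->
  forall i, measurable_fun [set: T] (fun x => f x ord0 i).
Proof.
pose coor (i : 'I_n) := fun x : 'rV[R]_n => x ord0 i.
apply: (@iff_trans _ (g_sigma_preimage (fun i => coor i \o f) `<=` measurable)).
  rewrite g_sigma_preimage_comp; split=> [mf A [/= C preC <-]|prefS].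
    exact: mf.
  by move=> _ A mA; apply: prefS; exists A.
split=> [coorfS i|mf].
- move=> _ A mA; apply: coorfS; apply: sub_sigma_algebra.
  rewrite -bigcup_seq/=; exists i => /=; first by rewrite mem_index_enum.
  by exists A.
- apply: smallest_sub; first exact: sigma_algebra_measurable.
  rewrite -bigcup_seq/=; apply: bigcup_sub => i _.
  by move=> A [B mB <-]; exact: mf.
Qed.

Lemma measurable_coor n (i : 'I_n) :
  measurable_fun [set: 'rV[R]_n] (fun x => x ord0 i).
Proof. by apply: (measurable_fun_rVP (fun x => x)).1; exact: measurable_id. Qed.

Definition cons_rV n (z : measurableTypeR R * 'rV[R]_n) : 'rV[R]_n.+1 :=
  row_mx (z.1 : R)%:M z.2 : 'rV[R]_(1 + n).

Definition uncons_rV n (x : 'rV[R]_n.+1) : measurableTypeR R * 'rV[R]_n :=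
  (x ord0 ord0, rsubmx (x : 'rV[R]_(1 + n))).

Lemma cons_rVK n : cancel (@cons_rV n) (@uncons_rV n).
Proof.
move=> [a x]; rewrite /uncons_rV /cons_rV row_mxKr; congr pair.
have -> : ord0 = lshift n ord0 :> 'I_(1 + n) by apply/val_inj.
by rewrite (@row_mxEl _ 1 1 n) !mxE.
Qed.

Lemma measurable_cons_rV n : measurable_fun setT (@cons_rV n).
Proof.
apply/measurable_fun_rVP => i; rewrite /cons_rV.
case: (splitP (i : 'I_(1 + n))) => j ij.
  have -> : i = lshift n j :> 'I_(1 + n) by apply/val_inj.
  under eq_fun do rewrite (@row_mxEl _ 1 1 n) (ord1 j) mxE /= mulr1n.
  exact: measurable_fst.
have -> : i = rshift 1 j :> 'I_(1 + n) by apply/val_inj.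
under eq_fun do rewrite (@row_mxEr _ 1 1 n).
exact: (measurableT_comp (measurable_coor j) measurable_snd).
Qed.

Lemma measurable_uncons_rV n : measurable_fun setT (@uncons_rV n).
Proof.
apply/measurable_fun_pairP; split; first exact: measurable_coor.
apply/measurable_fun_rVP => i /=.
under eq_fun do rewrite mxE.
exact: measurable_coor.
Qed.

Section cons_measure.
Local Open Scope ereal_scope.
Variables (n : nat) (mu : {sigma_finite_measure set 'rV[R]_n -> \bar R}).

Definition cons_measure : set 'rV[R]_n.+1 -> \bar R :=
  pushforward (@lebesgue_measure R \x mu) (@cons_rV n).

Let cons_measure0 : cons_measure set0 = 0.
Proof. by rewrite /cons_measure /pushforward preimage_set0 measure0. Qed.

Let cons_measure_ge0 A : 0 <= cons_measure A.
Proof. by apply: measure_ge0; exact: measurable_cons_rV. Qed.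

Let cons_measure_sigma_additive : semi_sigma_additive cons_measure.
Proof.
apply: measure_semi_sigma_additive; exact: measurable_cons_rV.
Qed.

HB.instance Definition _ := isMeasure.Build _ _ _ cons_measure
  cons_measure0 cons_measure_ge0 cons_measure_sigma_additive.

Let cons_measure_sigma_finite : sigma_finite setT cons_measure.
Proof.
have /sigma_finiteP[F [TF ndF Foo]] := sigma_finiteT (@lebesgue_measure R).
have /sigma_finiteP[G [TG ndG Goo]] := sigma_finiteT mu.
exists (fun k => @uncons_rV n @^-1` (F k `*` G k)).
  rewrite -preimage_bigcup [X in _ @^-1` X](_ : _ = setT) ?preimage_setT//.
  rewrite -setXTT TF TG predeqE => -[x y]; split.
    by move=> [k _ []/= ? ?]; split; exists k.
  move=> [/= [k _ Fkx] [l _ Gly]]; exists (maxn k l) => //; split.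
  - by move: x Fkx; exact/subsetPset/ndF/leq_maxl.
  - by move: y Gly; exact/subsetPset/ndG/leq_maxr.
move=> k; have [mF Fk] := Foo k; have [mG Gk] := Goo k.
have mFG : measurable (F k `*` G k) by exact: measurableX.
split.
  by rewrite -[X in measurable X]setTI; exact: measurable_uncons_rV.
rewrite /cons_measure /pushforward -comp_preimage.
rewrite (_ : _ \o _ = id) ?preimage_id; last first.
  by apply/funext => z; exact: cons_rVK.
by rewrite product_measure1E// lte_mul_pinfty// ge0_fin_numE.
Qed.

HB.instance Definition _ := Measure_isSigmaFinite.Build _ _ _ cons_measure
  cons_measure_sigma_finite.

End cons_measure.

Section point_measure.

Definition point_measure : set 'rV[R]_0 -> \bar R := \d_(0 : 'rV[R]_0).

HB.instance Definition _ := Measure.on point_measure.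

Let point_measure_sigma_finite : sigma_finite setT point_measure.
Proof.
exists (fun=> setT); first by rewrite bigcup_const.
by move=> k; split => //; rewrite /point_measure diracT ltry.
Qed.

HB.instance Definition _ := Measure_isSigmaFinite.Build _ _ _ point_measure
  point_measure_sigma_finite.

End point_measure.

(* Lebesgue measure on the Borel sets of R^n, as an iterated product. *)
Fixpoint lebesgue_rV n : {sigma_finite_measure set 'rV[R]_n -> \bar R} :=
  if n is m.+1 then cons_measure (lebesgue_rV m) else point_measure.

End lebesgue_measure_rV.

Section euclidean_geometry.
Context {R : realType} (d : nat).
Implicit Types (x y : 'rV[R]_d) (A C : set 'rV[R]_d).

Definition dot x y : R := \sum_i x ord0 i * y ord0 i.

(* The library's norm on 'rV[R]_d is the maximum norm. *)
Definition enorm x : R := Num.sqrt (dot x x).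

Definition eball x (r : R) : set 'rV[R]_d := [set y | enorm (y - x) < r].

Definition diam A : R := sup [set enorm (z.1 - z.2) | z in A `*` A].

Definition segment x y : set 'rV[R]_d :=
  [set (1 - s) *: x + s *: y | s in `[0, 1]].

Definition convex A := forall x y, A x -> A y -> segment x y `<=` A.

Definition convex_hull k (v : 'I_k -> 'rV[R]_d) : set 'rV[R]_d :=
  [set x | exists c : 'I_k -> R,
    [/\ forall j, 0 <= c j, \sum_j c j = 1 & x = \sum_j c j *: v j]].

(* A and the empty set are faces of A; the faces of a polytope are exactly its
   convex extreme subsets. *)
Definition face C A := [/\ A `<=` C, convex A &
  forall x y s, C x -> C y -> 0 < s < 1 -> A ((1 - s) *: x + s *: y) ->
    A x /\ A y].

Definition star_shaped_wrt A C :=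
  C `<=` A /\ forall x y, A x -> C y -> segment x y `<=` A.

Definition boundary A : set 'rV[R]_d := closure A `\` interior A.

(* Near each boundary point, A is the strict subgraph, in some direction e, of
   a Lipschitz function of the component orthogonal to e. *)
Definition lipschitz_boundary A := forall x, boundary A x ->
  exists (e : 'rV[R]_d) (r k : R) (phi : 'rV[R]_d -> R),
  [/\ enorm e = 1, 0 < r,
      forall y z, `|phi y - phi z| <= k * enorm (y - z) &
      forall y, eball x r y -> (A y <-> dot y e < phi (y - dot y e *: e))].

Definition polytopic A := exists (k : nat) (P : 'I_k -> set 'rV[R]_d),
  (forall j, exists (l : nat) (v : 'I_l -> 'rV[R]_d), P j = convex_hull v) /\
  closure A = \bigcup_j P j.

Definition polytopic_lipschitz_domain A :=
  [/\ A !=set0, open A, connected A & bounded_set A] /\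
  (lipschitz_boundary A /\ polytopic A).

End euclidean_geometry.

(* An H^1 function is carried together with its weak gradient, which it
   determines almost everywhere: w.2 stands for the gradient of w.1. *)
Definition h1fun (R : realType) (d : nat) : Type :=
  (('rV[R]_d -> R^o) * ('rV[R]_d -> 'rV[R]_d))%type.

HB.instance Definition _ (R : realType) (d : nat) :=
  GRing.Lmodule.copy (h1fun R d)
    (('rV[R]_d -> R^o) * ('rV[R]_d -> 'rV[R]_d))%type.

Section sobolev.
Context {R : realType} (d : nat) (Om : set 'rV[R]_d).
Notation mu := (@lebesgue_rV R d).

Definition square_integrable (v : 'rV[R]_d -> R) :=
  measurable_fun Om v /\ (\int[mu]_(x in Om) ((v x) ^+ 2)%:E < +oo)%E.

Definition ip (v w : 'rV[R]_d -> R) : R := \int[mu]_(x in Om) (v x * w x).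

Definition l2norm (v : 'rV[R]_d -> R) : R := Num.sqrt (ip v v).

Definition partial (i : 'I_d) (phi : 'rV[R]_d -> R) : 'rV[R]_d -> R :=
  fun x => 'D_(delta_mx ord0 i) phi x.

Definition grad (phi : 'rV[R]_d -> R) : 'rV[R]_d -> 'rV[R]_d :=
  fun x => \row_i partial i phi x.

Definition smooth (phi : 'rV[R]_d -> R) := forall s : seq 'I_d,
  continuous (foldr partial phi s) /\
  forall i x, derivable (foldr partial phi s) x (delta_mx ord0 i).

Definition test_function (phi : 'rV[R]_d -> R) := smooth phi /\
  exists K, [/\ compact K, K `<=` Om & forall x, ~ K x -> phi x = 0].

Definition weak_gradient (v : 'rV[R]_d -> R) (g : 'rV[R]_d -> 'rV[R]_d) :=
  forall phi, test_function phi -> forall i,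
  \int[mu]_(x in Om) (v x * partial i phi x) =
  - \int[mu]_(x in Om) (g x ord0 i * phi x).

Definition sobolev1 : set (h1fun R d) := [set w : h1fun R d |
  [/\ square_integrable w.1,
      forall i, square_integrable (fun x => w.2 x ord0 i) &
      weak_gradient w.1 w.2]].

Definition form (v w : h1fun R d) : R := \int[mu]_(x in Om) dot (v.2 x) (w.2 x).

Definition h1seminorm (w : h1fun R d) : R := Num.sqrt (form w w).

Definition h1norm (w : h1fun R d) : R :=
  Num.sqrt (l2norm w.1 ^+ 2 + h1seminorm w ^+ 2).

Definition sobolev10 : set (h1fun R d) := [set w : h1fun R d | sobolev1 w /\
  forall e, 0 < e -> exists2 phi, test_function phi &
    h1norm (w - ((phi, grad phi) : h1fun R d)) < e].

End sobolev.

Section finite_elements.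
Context {R : realType} (d : nat).

Inductive cell_type := simplicial | tensor_product.

Definition ref_cell (ct : cell_type) : set 'rV[R]_d :=
  match ct with
  | simplicial => [set x | (forall i, 0 <= x ord0 i) /\ \sum_i x ord0 i <= 1]
  | tensor_product => [set x | forall i, 0 <= x ord0 i <= 1]
  end.

Definition admissible (ct : cell_type) (q : nat) (a : {ffun 'I_d -> 'I_q.+1}) :=
  if ct is simplicial then (\sum_i a i <= q)%N else true.

(* Polynomials of total degree at most q (simplicial) or of degree at most q
   in each variable (tensor_product). *)
Definition ref_poly (ct : cell_type) (q : nat) : set ('rV[R]_d -> R) :=
  [set f : 'rV[R]_d -> R | exists c : {ffun 'I_d -> 'I_q.+1} -> R, forall x,
    f x = \sum_(a | admissible ct a) c a * \prod_i x ord0 i ^+ a i].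

(* Affine maps of the unit simplex, or multilinear maps of the unit cube (in
   particular boxes and parallelotopes). *)
Definition cell_map (ct : cell_type) (F : 'rV[R]_d -> 'rV[R]_d) :=
  (forall j, ref_poly ct 1 (fun x => F x ord0 j)) /\ set_inj (ref_cell ct) F.

Record mesh (ct : cell_type) := Mesh {
  ncells : nat ;
  cmap : 'I_ncells -> 'rV[R]_d -> 'rV[R]_d }.
Arguments cmap {ct} m i x.

Definition cell ct (K : mesh ct) i : set 'rV[R]_d := cmap K i @` ref_cell ct.
Arguments cell {ct} K i.

Definition conforming_mesh (Om : set 'rV[R]_d) ct (K : mesh ct) :=
  [/\ forall i, cell_map ct (cmap K i),
      closure Om = \bigcup_i cell K i &
      forall i j, i != j -> exists A B,
        [/\ face (ref_cell ct) A, A <> ref_cell ct,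
            face (ref_cell ct) B, B <> ref_cell ct &
            cell K i `&` cell K j = cmap K i @` A /\
            cell K i `&` cell K j = cmap K j @` B]].

Definition mesh_size ct (K : mesh ct) : R :=
  \big[Num.max/0]_i diam (cell K i).

Definition regular_mesh ct (K : mesh ct) (gamma : R) :=
  (forall i, exists x r,
     gamma * diam (cell K i) <= r /\ star_shaped_wrt (cell K i) (eball x r)) /\
  (forall i j, cell K i `&` cell K j !=set0 ->
     gamma * diam (cell K j) <= diam (cell K i)).

(* As the cells are closed, w.1 is continuous on closure Om: this is the
   Lagrangian space of order q with zero boundary values. *)
Definition fe_space (Om : set 'rV[R]_d) ct (K : mesh ct) (q : nat) :
  set (h1fun R d) := [set w : h1fun R d | sobolev10 Om w /\
    forall i, exists2 f, ref_poly ct q f &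
      forall x, ref_cell ct x -> w.1 (cmap K i x) = f x].

End finite_elements.

Section time.
Context {R : realType} (d : nat).
Implicit Types (V : set (h1fun R d)) (u : R -> 'rV[R]_d -> R).

(* Time derivatives and traces are taken pointwise in space; for piecewise
   polynomials in time they agree with those of V-valued functions. *)
Definition dt u : R -> 'rV[R]_d -> R := fun s x => derive1 (u ^~ x) s.

Definition rtrace u s : 'rV[R]_d -> R := fun x => lim (u r x @[r --> s^'+]).

Definition ltrace u s : 'rV[R]_d -> R := fun x => lim (u r x @[r --> s^'-]).

(* The equality also fixes the almost-everywhere representatives of the values
   W s, so that pointwise time derivatives make sense. *)
Definition poly_in_time (q : nat) (I : set R) V (W : R -> h1fun R d) :=
  exists2 c : 'I_q.+1 -> h1fun R d, forall k, V (c k) &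
    forall s, I s -> W s = \sum_(k < q.+1) s ^+ k *: c k.

(* L^2(I; L^2(Om)) is represented by jointly measurable functions. *)
Definition bochner_square_integrable (Om : set 'rV[R]_d) (I : set R) u :=
  measurable_fun (I `*` Om) (fun z : R * 'rV[R]_d => u z.1 z.2) /\
  (\int[lebesgue_measure]_(s in I) \int[lebesgue_rV d]_(x in Om)
     ((u s x) ^+ 2)%:E < +oo)%E.

Definition bochner_norm (Om : set 'rV[R]_d) (I : set R) u : R :=
  Num.sqrt (\int[lebesgue_measure]_(s in I) (l2norm Om (u s) ^+ 2)).

Definition slab (t : nat -> R) n : set R := `]t n.-1, t n].

Definition slab_sup (t : nat -> R) n (g : R -> R) : \bar R :=
  ess_sup (mrestr lebesgue_measure (measurable_itv `]t n.-1, t n]))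
    (fun s => (g s)%:E).

Definition time_grid (T : R) (N : nat) (t : nat -> R) :=
  [/\ t 0%N = 0, t N = T & forall n, (n < N)%N -> t n < t n.+1].

End time.

Section method.
Context {R : realType} (d : nat) (Om : set 'rV[R]_d).
Context (V : set (h1fun R d)) (T : R) (N : nat) (t : nat -> R) (p : nat -> nat).
Implicit Types (U : R -> h1fun R d).

(* vel U is meaningful inside each slab; its values at the nodes t n, where U
   may have a kink, only enter through the traces below. *)
Definition vel U : R -> 'rV[R]_d -> R := dt (fun s => (U s).1).

Definition trial_space (u0h : h1fun R d) : set (R -> h1fun R d) := [set U |
  [/\ forall s, s \in `[0, T] -> V (U s),
      forall s, s \in `[0, T] ->
        h1norm Om (U r - U s) @[r --> within `[0, T] (nbhs s)] --> 0,
      U 0 = u0h &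
      forall n, (1 <= n <= N)%N -> poly_in_time (p n) (slab t n) V U]].

(* The jump of the time derivative at t n.-1, with u1h in place of the left
   trace at the initial time. *)
Definition jump U (u1h : h1fun R d) n : 'rV[R]_d -> R :=
  rtrace (vel U) (t n.-1) \-
  (if n == 1%N then u1h.1 else ltrace (vel U) (t n.-1)).

Definition method_solution (f : R -> 'rV[R]_d -> R) (u0h u1h : h1fun R d) U :=
  trial_space u0h U /\
  forall n W, (1 <= n <= N)%N -> poly_in_time (p n).-1 (slab t n) V W ->
    \int[lebesgue_measure]_(s in slab t n)
      (ip Om (dt (vel U) s) (W s).1 + form Om (U s) (W s)) +
    ip Om (jump U u1h n) (rtrace (fun s => (W s).1) (t n.-1)) =
    \int[lebesgue_measure]_(s in slab t n) ip Om (f s) (W s).1.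

Definition slab_energy U n : \bar R :=
  (slab_sup t n (fun s => l2norm Om (vel U s)) ^+ 2 +
   slab_sup t n (fun s => h1seminorm Om (U s)) ^+ 2)%E.

Definition elliptic_projection (u uh : h1fun R d) :=
  V uh /\ forall v, V v -> form Om (u - uh) v = 0.

Definition l2_projection (u : 'rV[R]_d -> R) (uh : h1fun R d) :=
  V uh /\ forall v, V v -> ip Om (u \- uh.1) v.1 = 0.

End method.

(* Main.v *)
From HB Require Import structures.
From mathcomp Require Import all_boot all_order all_algebra.
From mathcomp Require Import all_classical all_reals all_analysis ess_sup_inf.
From mathcomp Require Import measurable_realfun.
From mathcomp Require Import ring lra.
Require Import Defs.

Set Implicit Arguments.
Unset Strict Implicit.
Unset Printing Implicit Defensive.
Import Order.TTheory GRing.Theory Num.Theory.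
Import numFieldNormedType.Exports.

Local Open Scope classical_set_scope.
Local Open Scope ring_scope.

(** On one time slab U is a polynomial in time, so its energies are polynomials
    whose coefficients come from two Gram matrices, and the estimate on a slab
    is an inequality between integrals of polynomials.

    Call energy the sum of the squared norms of U' and of the gradient of U.
    Testing with the velocity U' on a slab gives an exact balance: half the
    energy at the right end plus half the squared jump equals half the energy
    at the left end plus the work of f (residual_velocity). Summed over the
    slabs this controls the jumps and the energy at the nodes, but not yet the
    suprema over the slabs.

    On the slab I_m carrying the maximal energy X, of length tau and degree p,
    the test function is therefore phi U' with the decreasing weight
    phi = 1 - lam (t - t_{m-1}). Integration by parts then produces, besides
    the nodal energies, (lam / 2) times the integral of the energy over I_m.
    But phi U' has degree p in time, one too many, and the test function really
    used is its orthogonal projection w on degree p - 1. Replacing phi U' by w does not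
    affect the term in U'', which has degree p - 2. In the elastic term it adds
    a nonnegative quantity, since the part removed is a negative multiple of
    the top Legendre component of U. In the jump term it costs the inner
    product of the jump with that component, which for lam = 1 / (12 p tau) is
    absorbed by a quarter of the squared jump and half of the integral gained
    (weighted_test).

    An inverse estimate (inverse_estimate) bounds X by the integral of the
    energy over I_m times 2 (p + 1)^2 / tau, so that 2 mu_m X is at most what is
    left of the gain (stability_constant_le). Both the inverse estimate and the
    Legendre polynomials are obtained from one family of polynomials, those
    that represent evaluation at an endpoint of an interval (evalrep).

    The work of f is bounded by Young's inequality at almost every time
    (forcing_le). By maximality of I_m the squared L^2 norm in time of the test
    functions is at most t_m X, so that the right parameter leaves mu_m X,
    absorbed on the left, and t_m / (4 mu_m) times the squared norm of f.

    The remaining lemmas connect this computation with the Sobolev setting: the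
    forms are bilinear on pairs of square-integrable fields, the finite element
    space is a linear subspace of those, so that w is an admissible test
    function, and derivatives, traces and essential suprema of U on a slab are
    those of the polynomials. *)

(** * Integrals of polynomials *)

Section poly_integral.
Context {R : realType}.
Implicit Types (p q g w : {poly R}) (a b x y : R).

Lemma size_deriv_pred p : (size p^`() <= (size p).-1)%N.
Proof.
have [->|p0] := eqVneq p 0; first by rewrite deriv0 size_poly0.
by have := lt_size_deriv p0; case: (size p).
Qed.

Definition prim p : {poly R} := \poly_(i < (size p).+1) (p`_i.-1 / i%:R).

Lemma coef_prim p i : (prim p)`_i = if i is j.+1 then p`_j / i%:R else 0.
Proof.
rewrite coef_poly; case: i => [|i]; first by rewrite /= invr0 mulr0.
rewrite ltnS; case: ltnP => //= h; by rewrite nth_default ?mul0r.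
Qed.

Lemma deriv_prim p : (prim p)^`() = p.
Proof.
apply/polyP => i; rewrite coef_deriv coef_prim -[LHS]mulr_natr divfK//.
Qed.

Lemma deriv_eq0 p : p^`() = 0 -> p = (p.[0])%:P.
Proof.
move=> h; apply/polyP => -[|i]; first by rewrite coefC horner_coef0.
have := congr1 (fun q => q`_i) h; rewrite coef_deriv coef0 coefC/=.
by move/eqP; rewrite -mulr_natr mulf_eq0 pnatr_eq0 orbF => /eqP.
Qed.

(** The integral from a to b, as the increment of a primitive: linearity,
    integration by parts and substitution become identities of polynomials. *)
Definition pint a b p : R := (prim p).[b] - (prim p).[a].

Lemma pint_is_linear a b : scalar (pint a b).
Proof.
move=> c p q; rewrite /pint; have -> : prim (c *: p + q) = c *: prim p + prim q.
  apply/polyP => -[|i]; rewrite !(coefD, coefZ, coef_prim).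
    by rewrite mulr0 addr0.
  by rewrite mulrDl mulrA.
by rewrite !hornerE/=; ring.
Qed.

HB.instance Definition _ a b :=
  GRing.isLinear.Build R {poly R} R *%R (pint a b) (pint_is_linear a b).

Lemma pintZ a b c p : pint a b (c *: p) = c * pint a b p.
Proof. exact: linearZ. Qed.

Lemma pintD a b p q : pint a b (p + q) = pint a b p + pint a b q.
Proof. exact: linearD. Qed.

Lemma pintB a b p q : pint a b (p - q) = pint a b p - pint a b q.
Proof. exact: linearB. Qed.

Lemma pintMn a b p k : pint a b (p *+ k) = pint a b p *+ k.
Proof. exact: raddfMn. Qed.

Lemma pint_deriv a b p : pint a b p^`() = p.[b] - p.[a].
Proof.
have /deriv_eq0 h : (prim p^`() - p)^`() = 0.
  by rewrite derivB deriv_prim subrr.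
have e x : (prim p^`()).[x] = p.[x] + (prim p^`() - p).[0].
  have := congr1 (fun q => q.[x]) h; rewrite hornerC => <-.
  by rewrite hornerD hornerN addrC subrK.
by rewrite /pint !e; ring.
Qed.

Lemma pint_comp a b x y p :
  pint x y p * (b - a) =
  (y - x) * pint a b (p \Po (x%:P + ((y - x) / (b - a)) *: ('X - a%:P))).
Proof.
have [<-|ab] := eqVneq a b; first by rewrite /pint !subrr !mulr0.
have ba : b - a != 0 by rewrite subr_eq0 eq_sym.
set l := (X in _ \Po X).
have dl : l^`() = ((y - x) / (b - a))%:P.
  by rewrite /l derivD derivC derivZ derivXsubC add0r alg_polyC.
have la : l.[a] = x by rewrite /l !hornerE subrr mulr0 addr0.
have lb : l.[b] = y by rewrite /l !hornerE divfK// addrC subrK.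
have := pint_deriv a b (prim p \Po l).
rewrite deriv_comp deriv_prim dl mulrC mul_polyC linearZ/= !horner_comp la lb.
rewrite -/(pint x y p) => <-.
by rewrite mulrAC divfK.
Qed.

Lemma pint_swap a b p : pint a b p = - pint b a p.
Proof. by rewrite /pint opprB. Qed.

Lemma pint_split a x b p : pint a b p = pint a x p + pint x b p.
Proof. by rewrite /pint; ring. Qed.

Lemma pint_ge0 a b p : a <= b -> (forall x, a <= x <= b -> 0 <= p.[x]) ->
  0 <= pint a b p.
Proof.
move=> ab p0; rewrite subr_ge0.
apply: (@ger0_derive1_le_cc _ (horner (prim p)) a b).
- by move=> x _; exact: derivable_horner.
- move=> x /[!in_itv]/= /andP[ax xb].
  by rewrite -derivE deriv_prim p0// !ltW.
- by apply: continuous_subspaceT => x; exact: continuous_horner.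
- by rewrite in_itv/= lexx.
- by rewrite in_itv/= lexx andbT.
- exact: ab.
Qed.

Lemma pint_le a b p q : a <= b ->
  (forall x, a <= x <= b -> p.[x] <= q.[x]) -> pint a b p <= pint a b q.
Proof.
move=> ab pq; rewrite -subr_ge0 -linearB; apply: pint_ge0 => // x /pq h.
by rewrite !hornerE subr_ge0.
Qed.

Lemma pint_by_parts a b p q :
  pint a b (p^`() * q) = p.[b] * q.[b] - p.[a] * q.[a] - pint a b (p * q^`()).
Proof.
by rewrite -!hornerM -pint_deriv derivM linearD/= addrK.
Qed.

End poly_integral.

(** * Polynomials representing evaluation at an endpoint *)

Section representer.
Context {R : realType}.
Implicit Types (p r g : {poly R}) (q : nat).

(** Derivatives of order below the multiplicity of a zero vanish there, which
    removes the boundary terms of repeated integration by parts. *)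
Lemma derivn_exp_factor p r n j : (j <= n)%N ->
  exists r', (p ^+ n * r)^`(j) = p ^+ (n - j) * r'.
Proof.
elim: j => [|j IH] jn; first by exists r; rewrite subn0.
have [r' e] := IH (ltnW jn).
exists (p^`() * r' *+ (n - j) + p * r'^`()).
rewrite derivnS e derivM deriv_exp -(subnSK jn)/=.
rewrite exprS mulrnAl mulrDr mulrnAr !mulrA.
by congr (_ * _ *+ _ + _ * _); rewrite mulrC.
Qed.

Let w q : {poly R} := 'X^q * (1 - 'X) ^+ q.+1.

Let w0 q j : (j < q)%N -> (w q)^`(j).[0] = 0.
Proof.
move=> jq; rewrite /w.
have [r' ->] := derivn_exp_factor 'X ((1 - 'X) ^+ q.+1) (ltnW jq).
by rewrite hornerM hornerXn expr0n subn_eq0 leqNgt jq mul0r.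
Qed.

Let w1 q j : (j <= q)%N -> (w q)^`(j).[1] = 0.
Proof.
move=> jq; rewrite /w mulrC.
have [r' ->] := derivn_exp_factor (1 - 'X) ('X^q) (leqW jq).
by rewrite subSn// !hornerE subrr exprS mul0r mul0r.
Qed.

Let wq q : (w q)^`(q).[0] = q`!%:R.
Proof.
rewrite horner_coef0 coef_derivn addn0 /w coefXnM ltnn subnn ffactnn.
by rewrite -horner_coef0 !hornerE subr0 expr1n.
Qed.

Let wSq q : (w q)^`(q.+1).[0] = - (q.+1 ^ 2 * q`!)%:R.
Proof.
rewrite horner_coef0 coef_derivn addn0 /w coefXnM ltnNge leqnSn/= subSnn ffactnn.
have -> : ((1 - 'X : {poly R}) ^+ q.+1)`_1 = - q.+1%:R.
  rewrite -[LHS]mulr1n -(coef_deriv _ 0) -horner_coef0 deriv_exp derivB derivC derivX sub0r.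
  by rewrite hornerMn !hornerE subr0 expr1n mulr1 mulNrn.
by rewrite factS mulNrn -mulrnA mulnA mulnn.
Qed.

Let parts0 q j g : (j <= q)%N -> (size g <= j)%N ->
  pint 0 1 ((w q)^`(j) * g) = 0.
Proof.
elim: j g => [|j IH] g jq.
  by rewrite leqn0 size_poly_eq0 => /eqP->; rewrite mulr0 linear0.
move=> sg; rewrite derivnS pint_by_parts w0// w1 1?ltnW// !mul0r subrr sub0r.
rewrite (IH _ (ltnW jq)) ?oppr0//.
by rewrite (leq_trans (size_deriv_pred _))//; case: (size g) sg.
Qed.

(** The Rodrigues-type formula for the polynomial of degree q representing
    evaluation at the origin on the unit interval: all boundary terms of the
    repeated integration by parts vanish, except one at 0. *)
Definition evalrep q : {poly R} :=
  - (q`!%:R)^-1 *: ('X^q * (1 - 'X) ^+ q.+1)^`(q.+1).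

Lemma size_evalrep q : (size (evalrep q) <= q.+1)%N.
Proof.
apply: leq_trans (size_scale_leq _ _) _; apply/leq_sizeP => j qj.
rewrite coef_derivn nth_default ?mul0rn//.
have h : (size (w q) <= q.+1 + q.+1)%N.
  rewrite (leq_trans (size_polyMleq _ _))// size_polyXn/=.
  rewrite addSnnS leq_add2l.
  apply: leq_trans (size_poly_exp_leq _ _) _.
  rewrite -opprB size_polyN size_XsubC/= mul1n//.
by rewrite (leq_trans h)// leq_add2l.
Qed.

Lemma evalrep_pint q g : (size g <= q.+1)%N -> pint 0 1 (evalrep q * g) = g.[0].
Proof.
move=> sg; rewrite /evalrep -/(w q) -scalerAl linearZ/= pint_by_parts.
rewrite w1// wq mul0r sub0r parts0// ?subr0.
  by rewrite mulrN mulNr opprK mulKf// pnatr_eq0 -lt0n fact_gt0.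
apply: leq_trans (size_deriv_pred _) _.
by case: (size g) sg.
Qed.

(** As the representer reproduces itself, this value is also the integral of its
    square, hence the constant of the estimate of a polynomial at an endpoint. *)
Lemma evalrep0 q : (evalrep q).[0] = q.+1%:R ^+ 2.
Proof.
rewrite /evalrep hornerZ wSq mulrN mulNr opprK natrM mulrC mulfK ?natrX//.
Qed.

(** Consecutive representers agree against polynomials of lower degree, so
    their difference is a multiple of the Legendre polynomial of the unit
    interval, here normalised by its value at 0. *)
Definition legendre q : {poly R} :=
  (2 * q%:R + 1)^-1 *: (evalrep q - evalrep q.-1).

Let dpos q : 2 * q%:R + 1 != 0 :> R.
Proof. by rewrite gt_eqF// ltr_wpDl// mulr_ge0. Qed.

Lemma size_legendre_le q : (size (legendre q) <= q.+1)%N.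
Proof.
apply: leq_trans (size_scale_leq _ _) _; apply: leq_trans (size_polyD _ _) _.
rewrite geq_max size_evalrep size_polyN (leq_trans (size_evalrep _))//.
by rewrite ltnS leq_pred.
Qed.

Lemma legendre_orth q g : (0 < q)%N -> (size g <= q)%N ->
  pint 0 1 (legendre q * g) = 0.
Proof.
move=> q0 sg; rewrite -scalerAl linearZ/= mulrBl linearB/= !evalrep_pint//.
- by rewrite subrr mulr0.
- by rewrite prednK.
- exact: leqW.
Qed.

Lemma legendre0 q : (0 < q)%N -> (legendre q).[0] = 1.
Proof.
case: q => // q _; rewrite /legendre hornerZ hornerD hornerN !evalrep0/=.
have -> : q.+2%:R = q%:R + 2 :> R by rewrite -addn2 natrD.
have := dpos q.+1; have -> : q.+1%:R = q%:R + 1 :> R by rewrite -addn1 natrD.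
by move=> h; field.
Qed.

(** One factor expands into representers: the one of degree q evaluates the
    other factor at 0, the one of lower degree is orthogonal to it. *)
Lemma legendre_norm q : (0 < q)%N ->
  pint 0 1 (legendre q * legendre q) = (2 * q%:R + 1)^-1.
Proof.
move=> q0; rewrite {1}/legendre -scalerAl linearZ/= mulrBl linearB/=.
rewrite evalrep_pint ?size_legendre_le// legendre0//.
rewrite [evalrep _ * _]mulrC legendre_orth// ?subr0 ?mulr1//.
by rewrite (leq_trans (size_evalrep _))// prednK.
Qed.

End representer.

(** * Gram forms of polynomial vectors *)

Lemma size_comp_poly_le (R : idomainType) (p l : {poly R}) :
  (size l <= 2)%N -> (size (p \Po l) <= size p)%N.
Proof.
have [->|p0 sl] := eqVneq p 0; first by rewrite comp_poly0.
apply: leq_trans (size_comp_poly_leq _ _) _.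
rewrite -[leqRHS]prednK ?lt0n ?size_poly_eq0// ltnS -[leqRHS]muln1 leq_mul2l.
by apply/orP; right; case: (size l) sl => [|[|[]]].
Qed.

Section gram_form.
Context {S : comNzRingType} (n : nat) (G : 'M[S]_n).
Implicit Types x y z : 'rV[S]_n.

(** The scalars are arbitrary because the same form is used over the reals, for
    values at a time, and over polynomials, for functions of time. *)
Definition gform x y : S := (x *m G *m y^T) 0 0.

Lemma gformE x y : gform x y = \sum_i \sum_j x 0 i * G i j * y 0 j.
Proof.
rewrite exchange_big/= /gform mxE; apply: eq_bigr => j _; rewrite !mxE.
by rewrite mulr_suml.
Qed.

Lemma gformDl x y z : gform (x + y) z = gform x z + gform y z.
Proof. by rewrite /gform !mulmxDl mxE. Qed.

Lemma gformDr x y z : gform x (y + z) = gform x y + gform x z.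
Proof. by rewrite /gform linearD mulmxDr mxE. Qed.

Lemma gformZl a x y : gform (a *: x) y = a * gform x y.
Proof. by rewrite /gform -!scalemxAl mxE. Qed.

Lemma gformZr a x y : gform x (a *: y) = a * gform x y.
Proof. by rewrite /gform linearZ -scalemxAr mxE. Qed.

Lemma gformNl x y : gform (- x) y = - gform x y.
Proof. by rewrite -scaleN1r gformZl mulN1r. Qed.

Lemma gformNr x y : gform x (- y) = - gform x y.
Proof. by rewrite -scaleN1r gformZr mulN1r. Qed.

Lemma gform0l x : gform 0 x = 0.
Proof. by rewrite -(scale0r 0) gformZl mul0r. Qed.

Lemma gformC (Gsym : G^T = G) x y : gform x y = gform y x.
Proof.
rewrite !gformE exchange_big; apply: eq_bigr => i _; apply: eq_bigr => j _ /=.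
have -> : G j i = G i j by rewrite -[in LHS]Gsym mxE.
by rewrite mulrC [x 0 j * _]mulrC mulrA.
Qed.

Lemma gform_sqB (Gsym : G^T = G) x y c :
  gform (x - c *: y) (x - c *: y) =
  gform x x - c * gform x y *+ 2 + c * c * gform y y.
Proof.
rewrite gformDl gformNl gformZl !gformDr !gformNr !gformZr (gformC Gsym y x).
by rewrite mulr2n; ring.
Qed.

End gram_form.

Lemma map_gform (S S' : comNzRingType) (f : {rmorphism S -> S'}) n
    (G : 'M[S]_n) x y :
  f (gform G x y) = gform (map_mx f G) (map_mx f x) (map_mx f y).
Proof. by rewrite /gform matrix.map_trmx -!map_mxM [RHS]mxE. Qed.

Notation pform G := (gform (map_mx polyC G)).

Section poly_gram.
Context {R : realType} (n : nat).
Implicit Types (G A : 'M[R]_n) (u v w : 'rV[{poly R}]_n) (x y z e : 'rV[R]_n).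

Definition psd G := G^T = G /\ forall x, 0 <= gform G x x.

Definition peval v (s : R) : 'rV[R]_n := map_mx (horner_eval s) v.
Definition pderiv v : 'rV[{poly R}]_n := map_mx deriv v.
Definition pconst e : 'rV[{poly R}]_n := map_mx polyC e.
Definition psize q v := forall j, (size (v 0%R j) <= q)%N.

Lemma pform_sym G : psd G -> forall v w, pform G v w = pform G w v.
Proof. by case=> Gs _; apply: gformC; rewrite matrix.map_trmx Gs. Qed.

Lemma pevalE v s j : peval v s 0 j = (v 0 j).[s].
Proof. by rewrite mxE. Qed.

Lemma horner_pform G v w s : (pform G v w).[s] = gform G (peval v s) (peval w s).
Proof.
rewrite -[LHS]/(horner_eval s _) map_gform -map_mx_comp map_mx_id// => c /=.
by rewrite /horner_eval hornerC.
Qed.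

Lemma deriv_pform G v w :
  (pform G v w)^`() = pform G (pderiv v) w + pform G v (pderiv w).
Proof.
rewrite !gformE raddf_sum -big_split; apply: eq_bigr => i _.
rewrite raddf_sum -big_split; apply: eq_bigr => j _ /=.
by rewrite !mxE !derivM derivC mulr0 addr0.
Qed.

Lemma pint_pform_const G a b v e :
  pint a b (pform G v (pconst e)) = gform G (map_mx (pint a b) v) e.
Proof.
rewrite !gformE raddf_sum; apply: eq_bigr => i _.
rewrite raddf_sum; apply: eq_bigr => j _ /=.
rewrite !mxE -mulrA -rmorphM/= mulrC mul_polyC linearZ/= mulrC mulrA //.
Qed.

Lemma pint_pform_ge0 G a b v : psd G -> a <= b -> 0 <= pint a b (pform G v v).
Proof. by move=> [_ G0] ab; apply: pint_ge0 => // x _; rewrite horner_pform. Qed.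

Lemma pform_const G e e' : pform G (pconst e) (pconst e') = (gform G e e')%:P.
Proof. by rewrite map_gform. Qed.

(** Cauchy-Schwarz for a vector-valued moment: expand the integral of the form at
    v - kappa^-1 k e, which is nonnegative. *)
Lemma moment_le G a b (k : {poly R}) kappa v e : psd G -> a <= b -> 0 < kappa ->
    pint a b (k * k) <= kappa -> e = map_mx (pint a b) (k *: v) ->
  gform G e e <= kappa * pint a b (pform G v v).
Proof.
move=> Gpsd ab k0 kk ek; have [_ G0] := Gpsd.
set I := pint a b _; set N := gform G e e.
have ve : pint a b (k * pform G v (pconst e)) = N.
  by rewrite -gformZl pint_pform_const -ek.
have ee : pint a b (k * k * pform G (pconst e) (pconst e)) = pint a b (k * k) * N.
  by rewrite pform_const mulrC mul_polyC linearZ/= mulrC.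
have := pint_pform_ge0 (v - (kappa^-1 *: k) *: pconst e) Gpsd ab.
rewrite gform_sqB; last by rewrite map_trmx Gpsd.1.
have -> : (kappa^-1 *: k) * (kappa^-1 *: k) = (kappa^-1 * kappa^-1) *: (k * k).
  by rewrite -scalerAl -scalerAr scalerA.
rewrite -!scalerAl pintD pintB pintMn !pintZ ve ee.
have N0 : 0 <= N := G0 e.
have : kappa^-1 * kappa^-1 * (pint a b (k * k) * N) <= kappa^-1 * N.
  rewrite mulrA ler_wpM2r// -mulrA -[leRHS]mulr1 ler_wpM2l ?invr_ge0 ?(ltW k0)//.
  by rewrite mulrC ler_pdivrMr// mul1r.
rewrite -/I mulr2n; move: (pint a b (k * k) * N) => z h1 h2.
by rewrite -ler_pdivrMl//; lra.
Qed.

(** The factor 2 comes from restricting to the longer of the two subintervals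
    with endpoint x, on which x is an endpoint. *)
Lemma inverse_estimate G q (a b : R) v (x : R) : psd G -> a < b -> psize q.+1 v ->
    a <= x <= b ->
  gform G (peval v x) (peval v x) <=
  2 * q.+1%:R ^+ 2 / (b - a) * pint a b (pform G v v).
Proof.
move=> Gpsd ab sv /andP[ax xb]; have [_ G0] := Gpsd.
have endpoint (y : R) : x != y -> gform G (peval v x) (peval v x) <=
    q.+1%:R ^+ 2 / (y - x) * pint x y (pform G v v).
  move=> xy; set l : {poly R} := x%:P + ((y - x) / (1 - 0)) *: ('X - 0%:P).
  pose vl := map_mx (comp_poly l) v.
  have pl : pform G v v \Po l = pform G vl vl.
    rewrite (map_gform (comp_poly l)) -map_mx_comp; congr (gform _ _ _).
    by apply/matrixP => i j; rewrite !mxE/= comp_polyC.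
  have sl : (size l <= 2)%N.
    rewrite (leq_trans (size_polyD _ _))// geq_max (leq_trans (size_polyC_leq1 _))//=.
    by rewrite (leq_trans (size_scale_leq _ _))// size_XsubC.
  have := @moment_le G 0 1 (evalrep q) (q.+1%:R ^+ 2) vl (peval v x) Gpsd ler01.
  rewrite exprn_gt0// evalrep_pint ?size_evalrep// evalrep0 lexx.
  move=> /(_ isT isT) h.
  have -> : q.+1%:R ^+ 2 / (y - x) * pint x y (pform G v v) =
     q.+1%:R ^+ 2 * pint 0 1 (pform G vl vl).
    rewrite -mulrA; congr (_ * _).
    have := pint_comp 0 1 x y (pform G v v); rewrite -/l pl subr0 mulr1 => ->.
    rewrite mulKf// subr_eq0 eq_sym//.
  apply: h; apply/matrixP => i j; rewrite !mxE ord1 evalrep_pint.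
    by rewrite horner_comp /l hornerD hornerZ hornerXsubC hornerC subrr mulr0 addr0.
  by rewrite (leq_trans (size_comp_poly_le _ sl)).
have N0 : 0 <= q.+1%:R ^+ 2 :> R by exact: sqr_ge0.
have I0 (y z : R) : y <= z -> 0 <= pint y z (pform G v v) by exact: pint_pform_ge0.
have [lr|rl] := lerP (x - a) (b - x).
  have xb' : x < b by lra.
  apply: le_trans (endpoint b _) _; first by rewrite lt_eqF.
  rewrite [pint a b _](pint_split a x b).
  apply: ler_pM => //.
  - by rewrite divr_ge0// subr_ge0.
  - exact: I0.
  - rewrite [2 * _]mulrC -[leRHS]mulrA ler_wpM2l// ler_pdivlMr; last by lra.
    by rewrite mulrC ler_pdivrMr; lra.
  - by rewrite lerDr I0.
have xa : a < x by lra.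
apply: le_trans (endpoint a _) _; first by rewrite gt_eqF.
rewrite [pint a b _](pint_split a x b) pint_swap mulrN -mulNr -mulrN -invrN opprB.
apply: ler_pM => //.
- by rewrite divr_ge0// subr_ge0.
- exact: I0.
- rewrite [2 * _]mulrC -[leRHS]mulrA ler_wpM2l// ler_pdivlMr; last by lra.
  by rewrite mulrC ler_pdivrMr; lra.
- by rewrite lerDl I0.
Qed.

End poly_gram.

(** * Legendre polynomials of a slab *)

Section slab_legendre.
Context {R : realType}.
Implicit Types g : {poly R}.
Variables (a b : R) (p : nat).
Hypotheses (ab : a < b) (p_gt0 : (0 < p)%N).

Definition slab_legendre : {poly R} :=
  legendre p \Po ((b - a)^-1 *: ('X - a%:P)).
Local Notation L := slab_legendre.

Let ba0 : b - a != 0. Proof. by rewrite subr_eq0 gt_eqF. Qed.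

Let pint01 (g : {poly R}) : pint a b (L * g) =
  (b - a) * pint 0 1 (legendre p * (g \Po (a%:P + (b - a) *: 'X))).
Proof.
have := pint_comp 0 1 a b (L * g).
rewrite comp_polyM /L -comp_polyA !subr0 divr1 mulr1 => ->.
congr (_ * pint _ _ (_ * _)).
rewrite -[RHS]comp_polyXr; congr (_ \Po _).
rewrite comp_polyZ comp_polyB comp_polyX comp_polyC addrAC subrr add0r.
by rewrite scalerA mulVf// scale1r.
Qed.

Let size_lin (c d : R) : (size (c%:P + d *: 'X)%R <= 2)%N.
Proof.
rewrite (leq_trans (size_polyD _ _))// geq_max (leq_trans (size_polyC_leq1 _))//=.
by rewrite (leq_trans (size_scale_leq _ _))// size_polyX.
Qed.

Lemma slab_legendre_orth g : (size g <= p)%N -> pint a b (L * g) = 0.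
Proof.
move=> sg; rewrite pint01 legendre_orth ?mulr0//.
by rewrite (leq_trans (size_comp_poly_le _ (size_lin _ _))).
Qed.

Lemma slab_legendre_norm : pint a b (L * L) = (b - a) / (2 * p%:R + 1).
Proof.
rewrite pint01 -legendre_norm//; congr (_ * pint _ _ (_ * _)).
rewrite /L -comp_polyA -[RHS]comp_polyXr; congr (_ \Po _).
rewrite comp_polyZ comp_polyB comp_polyX comp_polyC addrAC subrr add0r.
by rewrite scalerA mulVf// scale1r.
Qed.

Lemma slab_legendre_left : L.[a] = 1.
Proof.
have e : ((b - a)^-1 *: ('X - a%:P)).[a] = 0.
  by rewrite hornerZ hornerXsubC subrr mulr0.
by rewrite horner_comp e legendre0.
Qed.

Lemma size_slab_legendre : (size L <= p.+1)%N.
Proof.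
rewrite (leq_trans (size_comp_poly_le _ _)) ?size_legendre_le//.
by rewrite (leq_trans (size_scale_leq _ _))// size_XsubC.
Qed.

Lemma slab_legendre_top_neq0 : L`_p != 0.
Proof.
have d0 : 2 * p%:R + 1 != 0 :> R by rewrite gt_eqF// ltr_wpDl// mulr_ge0.
apply/eqP => h; have : pint a b (L * L) != 0.
  by rewrite slab_legendre_norm mulf_neq0// invr_neq0.
move/eqP; apply; apply: slab_legendre_orth.
apply/leq_sizeP => j; rewrite leq_eqVlt => /predU1P[<-//|qj].
by rewrite nth_default// (leq_trans size_slab_legendre).
Qed.

(** Subtracting the multiple of L with the same top coefficient leaves a
    polynomial of lower degree, orthogonal to L. *)
Lemma slab_legendre_proj g : (size g <= p.+1)%N ->
  pint a b (L * g) = g`_p / L`_p * ((b - a) / (2 * p%:R + 1)).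
Proof.
move=> sg; have -> : g = (g - (g`_p / L`_p) *: L) + (g`_p / L`_p) *: L.
  by rewrite subrK.
rewrite mulrDr linearD/= slab_legendre_orth ?add0r; last first.
  apply/leq_sizeP => j; rewrite leq_eqVlt coefB coefZ => /predU1P[<-//|qj].
    by rewrite divfK ?subrr// slab_legendre_top_neq0.
  rewrite (nth_default 0 (leq_trans sg qj)).
  by rewrite (nth_default 0 (leq_trans size_slab_legendre qj)) mulr0 subrr.
rewrite -scalerAr linearZ/= slab_legendre_norm coefD coefB coefZ.
by rewrite divfK ?slab_legendre_top_neq0// subrr add0r.
Qed.

End slab_legendre.

(** * Test functions on a slab *)

Section slab_residual.
Context {R : realType} (n : nat).
Variables (G A : 'M[R]_n) (u : 'rV[{poly R}]_n) (z : 'rV[R]_n) (a b : R).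
Hypotheses (Gpsd : psd G) (Apsd : psd A).
Implicit Types w : 'rV[{poly R}]_n.

Local Notation u' := (pderiv u).
Local Notation u'' := (pderiv (pderiv u)).
Local Notation jmp := (peval u' a - z).
Local Notation sq B x := (gform B x x).

(** The vector z is the velocity at the end of the previous slab, which lives in
    the same coordinate space in order to form the jump. *)
Definition residual w : R :=
  pint a b (pform G u'' w + pform A u w) + gform G jmp (peval w a).

Let half_deriv (B : 'M[R]_n) v : psd B ->
  pform B (pderiv v) v = (2^-1 *: pform B v v)^`().
Proof.
move=> Bpsd; rewrite derivZ deriv_pform [pform B v _](pform_sym Bpsd).
rewrite scalerDr -scalerDl; have -> : 2^-1 + 2^-1 = 1 :> R by field.
by rewrite scale1r.
Qed.

Let sqB : 2^-1 * sq G z - 2^-1 * sq G (peval u' a) + gform G jmp (peval u' a) =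
  2^-1 * sq G jmp.
Proof.
have [Gs _] := Gpsd; have := gformC Gs.
rewrite gformDl !gformDr !gformDl !gformNl !gformNr => /(_ z (peval u' a)) ->.
by lra.
Qed.

(** Both integrands are derivatives of half the squares, and polarisation turns
    the boundary terms at a into the square of the jump. *)
Lemma residual_velocity :
  2^-1 * (sq G (peval u' b) + sq A (peval u b)) + 2^-1 * sq G jmp =
  2^-1 * (sq G z + sq A (peval u a)) + residual u'.
Proof.
rewrite -sqB /residual.
rewrite half_deriv// [pform A u _](pform_sym Apsd) half_deriv//.
rewrite -derivD pint_deriv !(hornerD, hornerZ) !horner_pform. lra.
Qed.

Section weighted.
Variable p : nat.
Hypotheses (ab : a < b) (p_gt0 : (0 < p)%N) (su : psize p.+1 u).

Let tau := b - a.
Let tau_gt0 : 0 < tau. Proof. by rewrite subr_gt0. Qed.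
Let pR : 1 <= p%:R :> R. Proof. by rewrite ler1n. Qed.
Let L := slab_legendre a b p.
Let top : 'rV[R]_n := \row_j ((u 0 j)`_p / L`_p).
(* By top_le, this lam makes om ^ 2 times the square of the top component at
   most lam / 4 times the integral of the squared velocity; 12 is 4 times the
   constant 3 there. The factor om = p * lam of the correction cancels the top
   coefficient of phi u'. *)
Let lam : R := (12 * p%:R * tau)^-1.
Let om : R := (12 * tau)^-1.
Let phi : {poly R} := (1 + lam * a)%:P - lam *: 'X.
Let w := phi *: u' + (om *: L) *: pconst top.

Let omE : om = p%:R * lam.
Proof.
rewrite /om /lam; have p0 : p%:R != 0 :> R by rewrite gt_eqF// ltr0n.
by have t0 := lt0r_neq0 tau_gt0; field; rewrite p0 t0.
Qed.

Let lam_gt0 : 0 < lam.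
Proof. by rewrite invr_gt0 !mulr_gt0// ltr0n. Qed.

Let phiE x : phi.[x] = 1 - lam * (x - a).
Proof. by rewrite /phi !hornerE; ring. Qed.

Let phi01 x : a <= x <= b -> 0 <= phi.[x] <= 1.
Proof.
move=> /andP[ax xb]; rewrite phiE.
have h : lam * (x - a) <= 1.
  rewrite ler_pdivrMl ?mulr_gt0 ?ltr0n// mulr1.
  rewrite -[leLHS]mul1r ler_pM// ?subr_ge0// ?lerD2r//.
  by move: pR; lra.
have : 0 <= lam * (x - a) by rewrite mulr_ge0 ?subr_ge0// ltW.
by move=> h'; apply/andP; split; lra.
Qed.

Let su' : psize p u'.
Proof.
by move=> j; rewrite mxE (leq_trans (size_deriv_pred _))//; have := su j; case: size.
Qed.

Let coef_u j i : (p < i)%N -> (u 0 j)`_i = 0.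
Proof. by move=> pi; rewrite nth_default// (leq_trans (su j)). Qed.

Let coef_u' j i : (p <= i)%N -> ((u 0 j)^`())`_i = 0.
Proof. by move=> pi; rewrite coef_deriv coef_u// mul0rn. Qed.

Let L0 : L`_p != 0 := slab_legendre_top_neq0 ab p_gt0.

Let sw : psize p w.
Proof.
move=> j; have -> : w 0 j = (1 + lam * a) *: (u 0 j)^`() -
    lam *: ('X * (u 0 j)^`()) + ((u 0 j)`_p / L`_p * om) *: L.
  rewrite !mxE/= mulrBl mul_polyC -scalerAl -scalerA.
  by rewrite [om *: L * _]mulrC mul_polyC.
have cancel_top (c g : R) : c * 0 - lam * (g *+ p) + g * om = 0.
  by rewrite omE -[_ *+ p]mulr_natr; ring.
have cancel_zero (c g : R) : c * 0 - lam * 0 + g * 0 = 0 by ring.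
apply/leq_sizeP => i; rewrite !(coefD, coefZ, coefN) coefXM.
rewrite leq_eqVlt => /predU1P[<-|pi].
  rewrite (gtn_eqF p_gt0) coef_u'// mulrAC divfK//.
  by rewrite coef_deriv prednK//; exact: cancel_top.
rewrite (nth_default 0 (leq_trans (size_slab_legendre _ _ _) pi)).
case: i pi => // i; rewrite ltnS => pi /=.
by rewrite (coef_u' j pi) (coef_u' j (leqW pi)); exact: cancel_zero.
Qed.

Let L_size p' (v : 'rV[{poly R}]_n) : psize p' v -> (p' <= p)%N ->
  map_mx (pint a b) (L *: v) = 0 :> 'rV[R]_n.
Proof.
move=> sv pp; apply/matrixP => i j; rewrite !mxE ord1.
by apply: slab_legendre_orth => //; rewrite (leq_trans (sv j)).
Qed.

Let L_u : map_mx (pint a b) (L *: u) = (tau / (2 * p%:R + 1)) *: top.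
Proof.
by apply/matrixP => i j; rewrite !mxE ord1 slab_legendre_proj// mulrC.
Qed.

(** The highest Legendre component of u, through its moment against the
    velocity weighted by the distance to the left end. *)
Let top_le : sq G top <= 3 * tau / p%:R * pint a b (pform G u' u').
Proof.
have p0 : 0 < p%:R :> R by rewrite ltr0n.
have d0 : 0 < 2 * p%:R + 1 :> R by rewrite addr_gt0// mulr_gt0.
pose k : 'rV[{poly R}]_n := ('X - a%:P) *: u'.
have momk : (p%:R * (tau / (2 * p%:R + 1))) *: top = map_mx (pint a b) (L *: k).
  apply/matrixP => i j; rewrite !mxE ord1 slab_legendre_proj//; last first.
    rewrite (leq_trans (size_polyMleq _ _))// size_XsubC/=.
    by have := su' j; rewrite mxE.
  have -> : (('X - a%:P) * (u 0 j)^`())`_p = (u 0 j)`_p *+ p - a * 0.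
    rewrite mulrBl mul_polyC coefB coefXM coefZ (gtn_eqF p_gt0) (coef_u' j (leqnn p)).
    by rewrite coef_deriv prednK.
  by rewrite mulr0 subr0 -[_ *+ p]mulr_natr -/tau -/L; ring.
have := @moment_le _ _ G a b L (tau / (2 * p%:R + 1)) k _ Gpsd (ltW ab) _ _ momk.
rewrite divr_gt0// slab_legendre_norm// lexx => /(_ isT isT).
rewrite gformZl gformZr => h.
have kle : pint a b (pform G k k) <= tau ^+ 2 * pint a b (pform G u' u').
  rewrite -linearZ/=; apply: pint_le; first exact: ltW.
  move=> x /andP[ax xb]; rewrite gformZl gformZr mulrA hornerM hornerZ.
  apply: ler_wpM2r; first by rewrite horner_pform; case: Gpsd.
  have h1 : 0 <= x - a by rewrite subr_ge0.
  have h2 : x - a <= tau by rewrite lerD2r.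
  by rewrite hornerM hornerXsubC -expr2 ler_pXn2r ?nnegrE// (le_trans h1 h2).
set Q := pint a b (pform G u' u') in kle *.
have {h kle} h := le_trans h (ler_wpM2l (ltW (divr_gt0 tau_gt0 d0)) kle).
have Q0 : 0 <= Q by apply: pint_pform_ge0 => //; exact: ltW.
suff : sq G top <= tau * (2 * p%:R + 1) / p%:R ^+ 2 * Q.
  move/le_trans; apply; rewrite ler_wpM2r// ler_pdivrMr ?exprn_gt0//.
  have -> : 3 * tau / p%:R * p%:R ^+ 2 = tau * (3 * p%:R) by field; rewrite gt_eqF.
  by rewrite ler_wpM2l ?(ltW tau_gt0)//; move: pR; lra.
have c0 : 0 < (p%:R * (tau / (2 * p%:R + 1))) ^+ 2.
  by rewrite exprn_gt0// mulr_gt0// divr_gt0.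
rewrite -(ler_pM2l c0); apply: le_trans (le_trans h _).
  by move: (p%:R * _) => c; rewrite expr2 -mulrA.
rewrite le_eqVlt; apply/orP; left; apply/eqP; field.
by rewrite !gt_eqF.
Qed.

Let weighted_parts (h : {poly R}) :
  pint a b (phi * h^`()) = phi.[b] * h.[b] - h.[a] + lam * pint a b h.
Proof.
have e : pint a b (h * phi^`()) = - (lam * pint a b h).
  rewrite /phi derivB derivC derivZ derivX sub0r alg_polyC mulrN mulrC mul_polyC.
  by rewrite linearN linearZ.
have pa : phi.[a] = 1 by rewrite phiE subrr mulr0 subr0.
by rewrite mulrC pint_by_parts e pa mulr1 opprK [h.[b] * _]mulrC.
Qed.

(** As w is orthogonal to the part removed, it is the orthogonal projection of
    phi u', and the weight is at most 1. *)
Let w_le : pint a b (pform G w w) <= pint a b (pform G u' u').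
Proof.
apply: (@le_trans _ _ (pint a b (pform G (phi *: u') (phi *: u')))).
  have -> : phi *: u' = w - (om *: L) *: pconst top by rewrite /w addrK.
  rewrite gform_sqB; last by rewrite map_trmx Gpsd.1.
  have e0 : pint a b ((om *: L) * pform G w (pconst top)) = 0.
    by rewrite -scalerAl pintZ -gformZl pint_pform_const (L_size sw)// gform0l mulr0.
  rewrite pintD pintB pintMn e0 mul0rn subr0 lerDl -mulrA -gformZr -gformZl.
  by apply: pint_pform_ge0 => //; exact: ltW.
apply: pint_le => [|x xab]; first exact: ltW.
have /andP[f0 f1] := phi01 xab.
have N0 : 0 <= (pform G u' u').[x] by rewrite horner_pform; case: Gpsd.
rewrite gformZl gformZr mulrA hornerM hornerM -[leRHS]mul1r ler_wpM2r//.
by rewrite -[1]mulr1 ler_pM.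
Qed.

Let residual_w :
  phi.[b] * (2^-1 * (sq G (peval u' b) + sq A (peval u b))) +
    lam / 2 * pint a b (pform G u' u' + pform A u u) +
    om * (tau / (2 * p%:R + 1)) * sq A top + om * gform G jmp top
    + 2^-1 * sq G jmp = 2^-1 * (sq G z + sq A (peval u a)) + residual w.
Proof.
rewrite -sqB /residual /w.
have -> : peval (phi *: u' + (om *: L) *: pconst top) a = peval u' a + om *: top.
  apply/matrixP => i j; rewrite !mxE /horner_eval ord1 hornerD !hornerM hornerC.
  by rewrite phiE hornerZ slab_legendre_left// subrr mulr0 subr0 mulr1 mul1r.
have sc (P : {poly R}) : om *: L * P = om *: (L * P) by rewrite scalerAl.
rewrite !gformDr !gformZr !sc.
rewrite [pform A u u'](pform_sym Apsd) !half_deriv//.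
rewrite !pintD !pintZ -!(gformZl _ L) !pint_pform_const.
rewrite (L_size (_ : psize p u''))//; last first.
  move=> j; rewrite mxE; apply: leq_trans (size_deriv_pred _) _.
  by rewrite (leq_trans (leq_pred _))// su'.
rewrite L_u gform0l !weighted_parts !hornerZ !horner_pform gformZl !pintZ.
by lra.
Qed.

(** The time-weighted velocity itself has degree one too many. Its projection
    onto lower degrees is an admissible test function, and the component that
    is removed has a favourable sign in the elastic term, because the leading
    coefficient of phi u' is a negative multiple of that of u. What it costs
    in the jump term is absorbed by the other terms. *)
Lemma weighted_test : exists w : 'rV[{poly R}]_n, [/\ psize p w,
    pint a b (pform G w w) <= pint a b (pform G u' u') &
    (48 * p%:R * (b - a))^-1 * pint a b (pform G u' u' + pform A u u) +
      4^-1 * sq G jmp <= 2^-1 * (sq G z + sq A (peval u a)) + residual w].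
Proof.
exists w; split=> //; rewrite -residual_w pintD -/tau.
have [_ G0] := Gpsd; have [_ A0] := Apsd.
have p0 : 0 < p%:R :> R by rewrite ltr0n.
have /andP[fb _] : 0 <= phi.[b] <= 1 by apply: phi01; rewrite lexx ltW.
have om_gt0 : 0 < om by rewrite invr_gt0 mulr_gt0.
have s1 : 0 <= phi.[b] * (2^-1 * (sq G (peval u' b) + sq A (peval u b))).
  by rewrite mulr_ge0// mulr_ge0// addr_ge0.
have s2 : 0 <= om * (tau / (2 * p%:R + 1)) * sq A top.
  have d0 : 0 <= 2 * p%:R + 1 :> R by rewrite addr_ge0// mulr_ge0.
  by rewrite mulr_ge0// mulr_ge0 ?(ltW om_gt0)// divr_ge0// (ltW tau_gt0).
have s3 : 0 <= 4^-1 * sq G jmp + om * gform G jmp top + om * om * sq G top.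
  have := G0 (jmp - (- 2 * om) *: top); rewrite gform_sqB ?Gpsd.1//.
  by rewrite mulr2n; lra.
have tl := top_le; set Q := pint a b (pform G u' u') in tl *.
set P := pint a b (pform A u u).
have Q0 : 0 <= Q by apply: pint_pform_ge0 => //; exact: ltW.
have P0 : 0 <= P by apply: pint_pform_ge0 => //; exact: ltW.
have s4 : om * om * sq G top <= lam / 4 * Q.
  apply: (@le_trans _ _ (om * om * (3 * tau / p%:R * Q))).
    by rewrite ler_wpM2l// mulr_ge0// ltW.
  rewrite mulrA ler_wpM2r// le_eqVlt; apply/orP; left; apply/eqP.
  by rewrite /om /lam; field; rewrite !gt_eqF.
have -> : (48 * p%:R * tau)^-1 = lam / 4.
  by rewrite /lam; field; rewrite !gt_eqF.
have lP : 0 <= lam * P by rewrite mulr_ge0// ltW.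
by lra.
Qed.

End weighted.

End slab_residual.

(** * Borel sets and Lebesgue measure in R^d *)

Section borel_rV.
Context {R : realType} (d : nat).
Notation mu := (@lebesgue_rV R d).

Lemma measurable_ball_rV (x : 'rV[R]_d) (r : R) : measurable (ball x r).
Proof.
have [r0|r0] := ltP 0 r; last first.
  rewrite (_ : ball x r = set0); first exact: measurable0.
  by apply/seteqP; split=> // y []; rewrite ltNge r0.
have -> : ball x r =
    \bigcap_(i in [set: 'I_d]) ((fun y : 'rV[R]_d => y ord0 i) @^-1` ball (x ord0 i) r).
  apply/seteqP; split=> [y [_ xy] i _ /=|y xy]; first exact: xy.
  by split=> // i j; rewrite (ord1 i); exact: (xy j I).
apply: fin_bigcap_measurable => [|i _]; first exact: finite_finset.
rewrite -[X in measurable X]setTI; apply: measurable_coor => //.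
exact: measurable_ball.
Qed.

(** An open set is the union of the countably many balls with rational centre
    and radius 1/(n+1) that it contains. *)
Lemma open_measurable_rV (A : set 'rV[R]_d) : open A -> measurable A.
Proof.
move=> oA.
pose B (z : 'rV[rat]_d * nat) : set 'rV[R]_d :=
  ball (map_mx ratr z.1 : 'rV[R]_d) (z.2.+1%:R^-1).
have -> : A = \bigcup_z [set x | B z `<=` A /\ B z x].
  apply/seteqP; split=> [x Ax|x [z _ [BA]]]; last exact: BA.
  have /nbhs_ballP[e /= e0 xe] : nbhs x A by exact: open_nbhs_nbhs.
  have [n ne] : exists n : nat, (n.+1%:R^-1 : R) < e / 2.
    have e2 : 0 < e / 2 by rewrite divr_gt0.
    by have [N _ /(_ _ (leqnn N))] := near_infty_natSinv_lt (PosNum e2); exists N.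
  have [eta etaE] : exists eta : R, eta = n.+1%:R^-1 by exists n.+1%:R^-1.
  have eta0 : 0 < eta by rewrite etaE invr_gt0.
  rewrite -etaE in ne.
  have /choice[q qP] : forall i : 'I_d, exists q : rat,
      `|x ord0 i - ratr q| < eta.
    move=> i; have : x ord0 i - eta < x ord0 i + eta by lra.
    move=> /rat_in_itvoo[q]; rewrite in_itv/= => /andP[q1 q2]; exists q.
    by rewrite ltr_norml; apply/andP; split; lra.
  exists (\row_i q i, n) => //=; rewrite /B/= -etaE; split=> [y [_ yq]|]; last first.
    by split=> // i j; rewrite !mxE ord1 /ball/= distrC; exact: qP.
  apply: xe; split=> // i j.
  have := qP j; have := yq i j; rewrite !mxE !(ord1 i) /ball/= => h1 h2.
  by rewrite (le_lt_trans (ler_distD (ratr (q j)) _ _))//; lra.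
apply: countable_bigcupT_measurable => // z.
have [BA|nBA] := pselect (B z `<=` A).
  rewrite (_ : [set _ | _] = B z); first exact: measurable_ball_rV.
  by apply/seteqP; split=> // x [].
rewrite (_ : [set _ | _] = set0); first exact: measurable0.
by apply/seteqP; split=> // x [].
Qed.

Lemma continuous_measurable_rV (f : 'rV[R]_d -> R) (D : set 'rV[R]_d) :
  continuous f -> measurable_fun D f.
Proof.
move=> cf; apply: (@measurable_funS _ _ _ _ setT) => //.
apply: (measurability _ (RGenOpens.measurableE R)) => //.
move=> _ [_ [a [b ->] <-]]; rewrite setTI; apply: open_measurable_rV.
by apply: open_comp => //; exact: interval_open.
Qed.

Definition box n (r : R) : set 'rV[R]_n :=
  [set x : 'rV[R]_n | forall i, `|x ord0 i| <= r].
Arguments box : clear implicits.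

Lemma bounded_sub_box (A : set 'rV[R]_d) : bounded_set A ->
  exists r, A `<=` box d r.
Proof.
move=> [M [Mreal AM]]; exists (`|M| + 1) => x Ax i.
have Mx : `|x| <= `|M| + 1.
  by apply: AM => //; rewrite (le_lt_trans (ler_norm M))// ltrDl.
apply: le_trans Mx; rewrite [leRHS]/Num.norm /= mx_normrE.
by apply/bigmax_geP; right => /=; exists (ord0, i).
Qed.

Lemma measurable_box n r : measurable (box n r).
Proof.
have -> : box n r = \bigcap_(i in [set: 'I_n])
    ((fun x : 'rV[R]_n => x ord0 i) @^-1` `[- r, r]).
  apply/seteqP; split=> x bx i; first by move=> _; rewrite /= in_itv/= -ler_norml.
  by have := bx i I; rewrite /= in_itv/= -ler_norml.
apply: fin_bigcap_measurable => [|i _]; first exact: finite_finset.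
rewrite -[X in measurable X]setTI; apply: measurable_coor => //.
Qed.

Lemma lebesgue_rV_box_lty n r : (@lebesgue_rV R n (box n r) < +oo)%E.
Proof.
elim: n => [|n IH] /=; first by rewrite /point_measure diracE ltry.
rewrite /cons_measure /pushforward.
have -> : @cons_rV R n @^-1` box n.+1 r = `[- r, r] `*` box n r.
  apply/seteqP; split=> -[a x]; rewrite /box/= in_itv/= -ler_norml.
    move=> h; split.
      have := h (lshift n ord0 : 'I_(1 + n)).
      by rewrite /cons_rV (@row_mxEl _ 1 1 n) !mxE.
    move=> i; have := h (rshift 1 i : 'I_(1 + n)).
    by rewrite /cons_rV (@row_mxEr _ 1 1 n).
  move=> [ha hx] i; rewrite /cons_rV.
  case: (splitP (i : 'I_(1 + n))) => j ij.
    have -> : i = lshift n j :> 'I_(1 + n) by apply/val_inj.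
    by rewrite (@row_mxEl _ 1 1 n) (ord1 j) mxE.
  have -> : i = rshift 1 j :> 'I_(1 + n) by apply/val_inj.
  by rewrite (@row_mxEr _ 1 1 n).
rewrite product_measure1E//; last exact: measurable_box.
have l : (lebesgue_measure (`[(- r)%R, r]%classic : set R) < +oo)%E.
  by rewrite lebesgue_measure_itv/=; case: ifP => _; rewrite ltry.
by rewrite lte_mul_pinfty// ge0_fin_numE.
Qed.

Lemma bounded_lebesgue_rV_lty (A : set 'rV[R]_d) : measurable A ->
  bounded_set A -> (mu A < +oo)%E.
Proof.
move=> mA /bounded_sub_box[r Ar].
apply: le_lt_trans (lebesgue_rV_box_lty d r).
by apply: le_measure => //; rewrite inE//; exact: measurable_box.
Qed.

(** Bounded sets lie in compact boxes. *)
Lemma continuous_bounded_rV (A : set 'rV[R]_d) (f : 'rV[R]_d -> R) :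
  bounded_set A -> continuous f -> exists M, forall x, A x -> `|f x| <= M.
Proof.
move=> /bounded_sub_box[r Ar] cf.
have cb : compact (box d r).
  rewrite (_ : box d r = [set v : 'rV[R]_d | forall i, `[- r, r]%classic (v ord0 i)]).
    by apply: (@rV_compact _ _ (fun=> `[- r, r]%classic)) => _; exact: segment_compact.
  by apply/seteqP; split=> x bx i; have := bx i; rewrite /= in_itv/= -ler_norml.
have /compact_bounded[M [_ fM]] :=
  continuous_compact (continuous_subspaceT cf) cb.
exists (M + 1) => x Ax; apply: (fM (M + 1)); first by rewrite ltrDl.
by exists x => //; exact: Ar.
Qed.

End borel_rV.

(** * Semidefinite forms on a subspace *)

Section partial_forms.
Context {R : realType} (E : lmodType R).
Implicit Types (S : set E) (B : E -> E -> R) (u v w : E).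

(** Integrals of products are additive only on functions for which they
    converge, so the forms of the problem are bilinear on a subspace only. *)
Record psd_form S B := PsdForm {
  psd_sym : forall u v, B u v = B v u ;
  psd_linear : forall a u v w, S u -> S v -> S w ->
    B (a *: u + v) w = a * B u w + B v w ;
  psd_ge0 : forall u, 0 <= B u u }.

Definition linear_space S := S 0 /\ forall a u v, S u -> S v -> S (a *: u + v).

Lemma linear_spaceZ S a u : linear_space S -> S u -> S (a *: u).
Proof. by move=> [S0 SL] Su; rewrite -[_ *: _]addr0; exact: SL. Qed.

Lemma linear_spaceD S u v : linear_space S -> S u -> S v -> S (u + v).
Proof. by move=> [S0 SL] Su Sv; rewrite -[u]scale1r; exact: SL. Qed.

Lemma linear_spaceB S u v : linear_space S -> S u -> S v -> S (u - v).
Proof. by move=> [S0 SL] Su Sv; rewrite addrC -scaleN1r; exact: SL. Qed.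

Lemma linear_space_sum S I (r : seq I) (P : pred I) (F : I -> E) :
  linear_space S -> (forall i, S (F i)) -> S (\sum_(i <- r | P i) F i).
Proof.
move=> SL SF; elim/big_ind : _ => // [|u v]; first by case: SL.
exact: linear_spaceD.
Qed.

Section theory.
Variables (S : set E) (B : E -> E -> R).
Hypotheses (SL : linear_space S) (BP : psd_form S B).

Lemma psdDl u v w : S u -> S v -> S w -> B (u + v) w = B u w + B v w.
Proof. by move=> *; rewrite -[in LHS](scale1r u) (psd_linear BP)// mul1r. Qed.

Lemma psdBl u v w : S u -> S v -> S w -> B (u - v) w = B u w - B v w.
Proof.
by move=> *; rewrite addrC -scaleN1r (psd_linear BP)// mulN1r addrC.
Qed.

Lemma psd0l w : S w -> B 0 w = 0.
Proof.
by move=> Sw; have := @psdBl 0 0 w SL.1 SL.1 Sw; rewrite !subrr.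
Qed.

Lemma psd_suml (I : finType) (x : I -> R) (c : I -> E) w :
  (forall i, S (c i)) -> S w ->
  B (\sum_i x i *: c i) w = \sum_i x i * B (c i) w.
Proof.
move=> Sc Sw; pose Q (s : E) (r : R) := S s /\ B s w = r.
suff : Q (\sum_i x i *: c i) (\sum_i x i * B (c i) w) by case.
elim/big_rec2 : _ => [|i s r _ [Ss Bs]]; first by split; [case: SL|exact: psd0l].
by split; [exact: SL.2|rewrite (psd_linear BP)// Bs].
Qed.

Definition gram n (c : 'I_n -> E) : 'M[R]_n := \matrix_(i, j) B (c i) (c j).

Lemma gramE n (c : 'I_n -> E) (x y : 'rV[R]_n) : (forall i, S (c i)) ->
  B (\sum_i x ord0 i *: c i) (\sum_j y ord0 j *: c j) = gform (gram c) x y.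
Proof.
move=> Sc; have Ssum (z : 'rV[R]_n) : S (\sum_j z ord0 j *: c j).
  by apply: linear_space_sum => // i; exact: linear_spaceZ.
rewrite gformE psd_suml//; apply: eq_bigr => i _.
rewrite (psd_sym BP) psd_suml// mulr_sumr; apply: eq_bigr => j _.
by rewrite mxE (psd_sym BP) mulrA mulrAC.
Qed.

Lemma gram_psd n (c : 'I_n -> E) : (forall i, S (c i)) -> psd (gram c).
Proof.
move=> Sc; split; first by apply/matrixP => i j; rewrite !mxE (psd_sym BP).
by move=> x; rewrite -gramE//; exact: (psd_ge0 BP).
Qed.

Lemma psd_sqD u v : S u -> S v -> B (u + v) (u + v) = B u u + 2 * B u v + B v v.
Proof.
move=> Su Sv; have Suv := linear_spaceD SL Su Sv.
rewrite psdDl// (psd_sym BP u) (psd_sym BP v) !psdDl// (psd_sym BP v u); ring.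
Qed.

Lemma psd_sqB u v : S u -> S v -> B (u - v) (u - v) = B u u - 2 * B u v + B v v.
Proof.
move=> Su Sv; have Suv := linear_spaceB SL Su Sv.
rewrite psdBl// (psd_sym BP u) (psd_sym BP v) !psdBl// (psd_sym BP v u); ring.
Qed.

Lemma psd_sqD_le u v : S u -> S v -> B (u + v) (u + v) <= 2 * B u u + 2 * B v v.
Proof.
move=> Su Sv; have := psd_ge0 BP (u - v); rewrite psd_sqB// psd_sqD//; lra.
Qed.

Lemma psd_sqZ a u : S u -> B (a *: u) (a *: u) = a ^+ 2 * B u u.
Proof.
move=> Su; have Z w : S w -> B (a *: u) w = a * B u w.
  by move=> Sw; have := psd_linear BP a Su SL.1 Sw; rewrite psd0l// !addr0.
have Sau := linear_spaceZ a SL Su.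
by rewrite Z// (psd_sym BP) Z// mulrA.
Qed.

Lemma psd_projection_le u uh : S u -> S uh -> B (u - uh) uh = 0 ->
  B uh uh <= B u u.
Proof.
move=> Su Suh; rewrite psdBl// => h.
by have := psd_ge0 BP (u - uh); rewrite psd_sqB//; lra.
Qed.

(** If u - v has zero norm, the form is affine and nonnegative along the line
    through v in the direction u - v, hence constant. *)
Lemma psd_null u v : S u -> S v -> B (u - v) (u - v) = 0 -> B u u = B v v.
Proof.
move=> Su Sv h; set w := u - v.
have Sw : S w := linear_spaceB SL Su Sv.
have e0 : B w v = 0.
  apply/eqP; apply/negPn/negP => b0.
  have N (t : R) : 0 <= B v v + 2 * (t * B w v).
    have Stw : S (t *: w) := linear_spaceZ t SL Sw.
    have := psd_ge0 BP (t *: w + v); rewrite psd_sqD// psd_sqZ// h mulr0.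
    by have := psd_linear BP t Sw SL.1 Sv; rewrite psd0l// !addr0 => ->; lra.
  have := N (- (B v v + 1) / B w v / 2).
  have -> : 2 * (- (B v v + 1) / B w v / 2 * B w v) = - (B v v + 1) by field.
  lra.
have -> : u = w + v by rewrite subrK.
by rewrite psd_sqD// e0 h mulr0 !add0r.
Qed.

End theory.
End partial_forms.

(** * Square-integrable functions *)

Section square_integrable.
Context {R : realType} (d : nat) (Om : set 'rV[R]_d).
Hypothesis mOm : measurable Om.
Notation mu := (@lebesgue_rV R d).
Implicit Types v w : 'rV[R]_d -> R.
Local Notation L2 := (square_integrable Om).

Lemma square_integrable_sq v : L2 v -> mu.-integrable Om (EFin \o (fun x => v x ^+ 2)).
Proof.
move=> [mv iv]; apply/integrableP; split.
  by apply/measurable_EFinP; exact: measurable_funX.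
under eq_integral do rewrite /= ger0_norm ?sqr_ge0//.
exact: iv.
Qed.

Lemma square_integrableM v w : L2 v -> L2 w ->
  mu.-integrable Om (EFin \o (fun x => v x * w x)).
Proof.
move=> Lv Lw; apply: (@le_integrable _ _ _ mu Om mOm _
    (EFin \o (fun x => v x ^+ 2 + w x ^+ 2))).
- by apply/measurable_EFinP; apply: measurable_funM; [case: Lv|case: Lw].
- move=> x _; rewrite /= lee_fin [leRHS]ger0_norm ?addr_ge0 ?sqr_ge0//.
  have h1 := sqr_ge0 (v x + w x); have h2 := sqr_ge0 (v x - w x).
  have h3 := sqr_ge0 (v x); have h4 := sqr_ge0 (w x).
  by rewrite ler_norml; apply/andP; split; nra.
- exact: (integrableD mOm (square_integrable_sq Lv) (square_integrable_sq Lw)).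
Qed.

Lemma square_integrableP v : measurable_fun Om v ->
  mu.-integrable Om (EFin \o (fun x => v x * v x)) -> L2 v.
Proof.
move=> mv /integrableP[_ iv]; split=> //; apply: le_lt_trans iv.
apply: ge0_le_integral => //.
- by move=> x _; rewrite lee_fin sqr_ge0.
- by apply/measurable_EFinP; exact: measurable_funX.
- apply/measurable_EFinP; apply: measurableT_comp => //.
  exact: measurable_funM.
- by move=> x _; rewrite /= lee_fin expr2 ler_norm.
Qed.

Lemma square_integrable_lin a v w : L2 v -> L2 w -> L2 (fun x => a * v x + w x).
Proof.
move=> Lv Lw.
have m : measurable_fun Om (fun x => a * v x + w x).
  by apply: measurable_funD; [apply: measurable_funM => //; case: Lv|case: Lw].
apply: square_integrableP => //.
have iv := integrableZl mOm (a ^+ 2) (square_integrable_sq Lv).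
have ivw := integrableZl mOm (2 * a) (square_integrableM Lv Lw).
have := integrableD mOm (integrableD mOm iv ivw) (square_integrable_sq Lw).
by apply: eq_integrable => // x _ /=; rewrite -!EFinM -!EFinD; congr EFin; ring.
Qed.

Lemma square_integrable0 : L2 (fun=> 0).
Proof.
split; first exact: measurable_cst.
by rewrite expr0n/= integral0 ltry.
Qed.

Lemma bounded_square_integrable v M : (mu Om < +oo)%E -> measurable_fun Om v ->
  (forall x, Om x -> `|v x| <= M) -> L2 v.
Proof.
move=> Omoo mv vM; apply: square_integrableP => //.
apply: measurable_bounded_integrable => //.
  exact: measurable_funM.
exists (M ^+ 2); split; first exact: num_real.
move=> r Mr x Omx /=; rewrite normrM (le_trans _ (ltW Mr))// -expr2.
by rewrite ler_pXn2r ?nnegrE ?vM// (le_trans _ (vM _ Omx)).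
Qed.

Lemma ip_lin a u v w : L2 u -> L2 v -> L2 w ->
  ip Om (fun x => a * u x + v x) w = a * ip Om u w + ip Om v w.
Proof.
move=> Lu Lv Lw; rewrite /ip -RintegralZl//; last exact: square_integrableM.
rewrite -RintegralD//; last 2 first.
- exact: (integrableZl mOm a (square_integrableM Lu Lw)).
- exact: square_integrableM.
by apply: eq_Rintegral => x _; ring.
Qed.

Lemma ipC v w : ip Om v w = ip Om w v.
Proof. by apply: eq_Rintegral => x _; rewrite mulrC. Qed.

Lemma ip_ge0 v : 0 <= ip Om v v.
Proof. by apply: Rintegral_ge0 => x _; rewrite -expr2 sqr_ge0. Qed.

(** The natural common domain of the two forms. A function without a gradient,
    such as u_1, is paired with the zero field. *)
Definition l2pair : set (h1fun R d) := [set w : h1fun R d |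
  square_integrable Om w.1 /\ forall i, square_integrable Om (fun x => w.2 x ord0 i)].

Lemma l2pair_linear : linear_space l2pair.
Proof.
split=> [|a u v [u1 u2] [v1 v2]].
  split; first exact: square_integrable0.
  move=> i; rewrite (_ : (fun _ => _) = fun=> 0); first exact: square_integrable0.
  by apply/funext => x; rewrite mxE.
split; first exact: (square_integrable_lin a u1 v1).
move=> i; rewrite (_ : (fun _ => _) = fun x => a * u.2 x ord0 i + v.2 x ord0 i).
  exact: (square_integrable_lin a (u2 i) (v2 i)).
by apply/funext => x; rewrite !mxE.
Qed.

Definition l2form (u v : h1fun R d) : R := ip Om u.1 v.1.

Lemma psd_ip : psd_form l2pair l2form.
Proof.
split=> [u v|a u v w [u1 _] [v1 _] [w1 _]|u]; first exact: ipC.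
  exact: ip_lin.
exact: ip_ge0.
Qed.

Lemma formE (u v : h1fun R d) : l2pair u -> l2pair v ->
  form Om u v = \sum_i ip Om (fun x => u.2 x ord0 i) (fun x => v.2 x ord0 i).
Proof.
move=> [_ u2] [_ v2]; rewrite /form /ip /Rintegral.
under eq_integral do rewrite /dot -sumEFin.
rewrite integral_sum//; last by move=> i; exact: square_integrableM.
rewrite -sum_fine// => i _.
by apply: integrable_fin_num => //; exact: square_integrableM.
Qed.

Lemma psd_h1form : psd_form l2pair (form Om).
Proof.
split=> [u v|a u v w Lu Lv Lw|u].
- by apply: eq_Rintegral => x _; apply: eq_bigr => i _; rewrite mulrC.
- rewrite !formE//; last exact: l2pair_linear.2.
  rewrite mulr_sumr -big_split; apply: eq_bigr => i _ /=.
  rewrite -ip_lin; [|exact: Lu.2|exact: Lv.2|exact: Lw.2].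
  by apply: eq_Rintegral => x _; rewrite !mxE.
- by apply: Rintegral_ge0 => x _; apply: sumr_ge0 => i _; rewrite -expr2 sqr_ge0.
Qed.

End square_integrable.

(** * Linearity of the finite element space *)

Section sobolev_spaces.
Context {R : realType} (d : nat) (Om : set 'rV[R]_d).
Hypotheses (oOm : open Om) (bOm : bounded_set Om).
Notation mu := (@lebesgue_rV R d).
Implicit Types (phi psi : 'rV[R]_d -> R) (u v w : h1fun R d).

Let mOm : measurable Om. Proof. exact: open_measurable_rV. Qed.
Let Omoo : (mu Om < +oo)%E. Proof. exact: bounded_lebesgue_rV_lty. Qed.

Lemma partial_lin a phi psi i : (forall x, derivable phi x (delta_mx ord0 i)) ->
    (forall x, derivable psi x (delta_mx ord0 i)) ->
  partial i (fun x => a * phi x + psi x) =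
  (fun x => a * partial i phi x + partial i psi x).
Proof.
move=> d1 d2; apply/funext => x; rewrite /partial.
rewrite -[X in 'D_ _ X _]/((a \*: (phi : 'rV[R]_d -> R^o)) + (psi : 'rV[R]_d -> R^o)).
by rewrite deriveD// ?deriveZ//; exact: derivableZ.
Qed.

Lemma foldr_partial_lin a phi psi s : smooth phi -> smooth psi ->
  foldr (@partial R d) (fun x => a * phi x + psi x) s =
  (fun x => a * foldr (@partial R d) phi s x + foldr (@partial R d) psi s x).
Proof.
move=> s1 s2; elim: s => //= i s ->; apply: partial_lin => x.
  by have [_] := s1 s; exact.
by have [_] := s2 s; exact.
Qed.

Lemma smooth_lin a phi psi : smooth phi -> smooth psi ->
  smooth (fun x => a * phi x + psi x).
Proof.
move=> s1 s2 s; rewrite foldr_partial_lin//.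
have [c1 d1] := s1 s; have [c2 d2] := s2 s; split.
  move=> x; exact: (cvgD (cvgM (cvg_cst a) (c1 x)) (c2 x)).
move=> i x.
rewrite -[X in derivable X]/((a \*: (foldr (@partial R d) phi s : 'rV[R]_d -> R^o)) +
  (foldr (@partial R d) psi s : 'rV[R]_d -> R^o)).
by apply: derivableD => //; exact: derivableZ.
Qed.

Lemma smooth0 : smooth (fun _ : 'rV[R]_d => 0 : R).
Proof.
move=> s; have -> : foldr (@partial R d) (fun _ : 'rV[R]_d => 0 : R) s = fun=> 0.
  elim: s => //= i s ->; apply/funext => x.
  by rewrite /partial derive_cst.
split=> [x|i x]; last by exact: derivable_cst.
exact: cst_continuous.
Qed.

Lemma test_function_lin a phi psi : test_function Om phi ->
  test_function Om psi -> test_function Om (fun x => a * phi x + psi x).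
Proof.
move=> [s1 [K1 [cK1 K1O p1]]] [s2 [K2 [cK2 K2O p2]]].
split; first exact: smooth_lin.
exists (K1 `|` K2); split; first exact: compactU.
  by move=> x [/K1O|/K2O].
by move=> x /not_orP[/p1-> /p2->]; rewrite mulr0 addr0.
Qed.

Lemma test_function0 : test_function Om (fun=> 0).
Proof.
by split; [exact: smooth0|exists set0; split => //; exact: compact0].
Qed.

Lemma continuous_square_integrable phi : continuous phi -> square_integrable Om phi.
Proof.
move=> cp; have [M pM] := continuous_bounded_rV bOm cp.
by apply: (bounded_square_integrable mOm) pM => //; exact: continuous_measurable_rV.
Qed.

Lemma test_function_l2pair phi : test_function Om phi ->
  l2pair Om (phi, grad phi).
Proof.
move=> [sp _]; split=> [|i] /=.
  by apply: continuous_square_integrable; case: (sp [::]).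
apply: continuous_square_integrable => x; rewrite /grad.
under eq_fun do rewrite mxE.
by case: (sp [:: i]) => + _; exact.
Qed.

Definition h1form u v := l2form Om u v + form Om u v.

Lemma psd_h1 : psd_form (l2pair Om) h1form.
Proof.
have P1 := psd_ip mOm; have P2 := psd_h1form mOm.
split=> [u v|a u v w Lu Lv Lw|u].
- by rewrite /h1form (psd_sym P1) (psd_sym P2).
- by rewrite /h1form (psd_linear P1)// (psd_linear P2)//; ring.
- by rewrite addr_ge0 ?(psd_ge0 P1) ?(psd_ge0 P2).
Qed.

Lemma h1normE w : h1norm Om w = Num.sqrt (h1form w w).
Proof.
rewrite /h1norm /l2norm /h1seminorm !sqr_sqrtr//.
  exact: (psd_ge0 (psd_h1form mOm)).
exact: (psd_ge0 (psd_ip mOm)).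
Qed.

Lemma h1norm_lt w e : 0 < e -> (h1norm Om w < e) = (h1form w w < e ^+ 2).
Proof.
move=> e0; rewrite -(@ltr_pXn2r _ 2) ?nnegrE ?sqrtr_ge0 ?(ltW e0)// h1normE sqr_sqrtr//.
exact: (psd_ge0 psd_h1).
Qed.

Let Rint0 (g : 'rV[R]_d -> R) : (forall x, Om x -> g x = 0) ->
  \int[mu]_(x in Om) g x = 0.
Proof.
move=> g0; rewrite (@eq_Rintegral _ _ _ _ _ (fun=> 0)).
  by rewrite Rintegral_cst// mul0r.
by move=> x /set_mem /g0.
Qed.

Lemma sobolev10_l2pair : sobolev10 Om `<=` l2pair Om.
Proof. by move=> w [[w1 w2 _] _]. Qed.

Lemma weak_gradient_lin a u v : l2pair Om u -> l2pair Om v ->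
  weak_gradient Om u.1 u.2 -> weak_gradient Om v.1 v.2 ->
  weak_gradient Om (a *: u + v).1 (a *: u + v).2.
Proof.
move=> [u1 u2] [v1 v2] wu wv phi tphi i.
have [p1 p2] := test_function_l2pair tphi.
have {}p2 : square_integrable Om (partial i phi).
  by have := p2 i; rewrite /grad/=; under eq_fun do rewrite mxE.
have -> : \int[mu]_(x in Om) ((a *: u + v).1 x * partial i phi x) =
    a * ip Om u.1 (partial i phi) + ip Om v.1 (partial i phi).
  by rewrite -ip_lin.
rewrite [ip Om u.1 _]wu// [ip Om v.1 _]wv//.
have -> : \int[mu]_(x in Om) ((a *: u + v).2 x ord0 i * phi x) =
    a * ip Om (fun x => u.2 x ord0 i) phi + ip Om (fun x => v.2 x ord0 i) phi.
  by rewrite -ip_lin//; apply: eq_Rintegral => x _; rewrite !mxE.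
by rewrite /ip; ring.
Qed.

(** Linear combinations of approximating test functions approximate the linear
    combination, the squared norm being subadditive up to a factor 2. *)
Lemma sobolev10_linear : linear_space (sobolev10 Om).
Proof.
have L := l2pair_linear mOm; have P := psd_h1.
split.
  split.
    split; [exact: L.1.1|exact: L.1.2|].
    move=> phi _ i.
    by rewrite !Rint0 ?oppr0// => x _; rewrite ?mul0r// mxE mul0r.
  move=> e e0; exists (fun=> 0); first exact: test_function0.
  have -> : grad (fun _ : 'rV[R]_d => 0 : R) = 0.
    apply/funext => x; apply/rowP => i; rewrite !mxE.
    by rewrite /partial derive_cst.
  by rewrite subrr h1norm_lt// (psd0l L P) ?exprn_gt0//; exact: L.1.
move=> a u v [[u1 u2 wu] au] [[v1 v2 wv] av].
have Lu : l2pair Om u by [].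
have Lv : l2pair Om v by [].
have [Lw1 Lw2] : l2pair Om (a *: u + v) by exact: L.2.
split; first by split=> //; exact: weak_gradient_lin.
move=> e e0.
have a1 : 0 < `|a| + 1 by rewrite ltr_wpDl.
have e1 : 0 < e / (2 * (`|a| + 1)) by rewrite divr_gt0// mulr_gt0.
have e2 : 0 < e / 2 by rewrite divr_gt0.
have [phi tphi] := au _ e1; have [psi tpsi] := av _ e2.
have Lphi := test_function_l2pair tphi; have Lpsi := test_function_l2pair tpsi.
set Y := v - _; set X := u - _ => hpsi hphi.
have {}hphi : h1form X X < (e / (2 * (`|a| + 1))) ^+ 2 by rewrite -h1norm_lt.
have {}hpsi : h1form Y Y < (e / 2) ^+ 2 by rewrite -h1norm_lt.
exists (fun x => a * phi x + psi x); first exact: test_function_lin.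
have LX : l2pair Om X by exact: linear_spaceB.
have LY : l2pair Om Y by exact: linear_spaceB.
have -> : a *: u + v - (((fun x => a * phi x + psi x),
    grad (fun x => a * phi x + psi x)) : h1fun R d)
   = a *: X + Y.
  have -> : grad (fun x => a * phi x + psi x) = a *: grad phi + grad psi.
    apply/funext => x; apply/rowP => i; rewrite !mxE partial_lin ?mxE//.
      by move=> y; case: tphi => /(_ [::])[_ + _]; exact.
    by move=> y; case: tpsi => /(_ [::])[_ + _]; exact.
  rewrite /X /Y scalerBr addrACA -opprD; congr (_ - _).
have Q := psd_sqD_le L P (linear_spaceZ a L LX) LY.
rewrite h1norm_lt//; apply: le_lt_trans Q _.
rewrite (psd_sqZ L P)//.
have h : a ^+ 2 * h1form X X <= (e / 2) ^+ 2.
  apply: (@le_trans _ _ (a ^+ 2 * (e / (2 * (`|a| + 1))) ^+ 2)).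
    by rewrite ler_wpM2l ?sqr_ge0// ltW.
  have -> : (e / (2 * (`|a| + 1))) ^+ 2 = (e / 2) ^+ 2 / (`|a| + 1) ^+ 2.
    by field; rewrite gt_eqF.
  rewrite mulrCA ler_piMr ?sqr_ge0// ler_pdivrMr ?exprn_gt0// mul1r.
  rewrite -[a ^+ 2]real_normK ?num_real// ler_pXn2r ?nnegrE ?(ltW a1)//.
  by rewrite lerDl.
have -> : e ^+ 2 = 2 * (e / 2) ^+ 2 + 2 * (e / 2) ^+ 2 by field.
by apply: ler_ltD; rewrite ?ler_pM2l ?ltr_pM2l.
Qed.

Lemma fe_space_linear ct (K : mesh d ct) q : linear_space (fe_space Om K q).
Proof.
split; first split.
- exact: sobolev10_linear.1.
- move=> i; exists (fun=> 0) => // .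
  by exists (fun=> 0) => x; rewrite big1// => a _; rewrite mul0r.
move=> a u v [Su fu] [Sv fv]; split; first exact: sobolev10_linear.2.
move=> i; have [g [c gE] ug] := fu i; have [g' [c' gE'] vg] := fv i.
exists (fun x => a * g x + g' x).
  exists (fun k => a * c k + c' k) => x; rewrite gE gE' mulr_sumr -big_split.
  by apply: eq_bigr => k _ /=; ring.
by move=> x rx; rewrite -ug// -vg.
Qed.

Lemma fe_space_l2pair ct (K : mesh d ct) q : fe_space Om K q `<=` l2pair Om.
Proof. by move=> w [/sobolev10_l2pair]. Qed.

End sobolev_spaces.

(** * The work of the forcing term *)

Section time_integrals.
Context {R : realType}.
Notation leb := (@lebesgue_measure R).
Implicit Types (P : {poly R}) (a b : R).

Lemma measurable_horner_itv P (D : set R) : measurable D -> measurable_fun D (horner P).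
Proof.
move=> mD; apply: (@measurable_funS _ _ _ _ setT) => //.
by apply: continuous_measurable_fun; exact: continuous_horner.
Qed.

Lemma integrable_horner P a b : a < b -> leb.-integrable `]a, b[ (EFin \o horner P).
Proof.
move=> ab; apply: (@integrableS _ _ _ leb `[a, b]) => //.
  by apply: subset_itvW; rewrite bnd_simp.
apply: continuous_compact_integrable; first exact: segment_compact.
by apply: continuous_subspaceT => x; exact: continuous_horner.
Qed.

Lemma Rintegral_horner P a b : a < b ->
  \int[leb]_(s in `]a, b[) P.[s] = pint a b P.
Proof.
move=> ab; rewrite /Rintegral -(@integral_itv_bndoo _ _ _ _ true false); last first.
  by apply/measurable_EFinP; apply: measurable_horner_itv.
rewrite (@continuous_FTC2 _ _ (horner (prim P)))//.
- by apply: continuous_subspaceT => x; exact: continuous_horner.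
- split; first by move=> x _; exact: derivable_horner.
    by apply: cvg_at_right_filter; exact: continuous_horner.
  by apply: cvg_at_left_filter; exact: continuous_horner.
- by move=> x _; rewrite -derivE deriv_prim.
Qed.

End time_integrals.

Section forcing.
Context {R : realType} (d : nat) (Om : set 'rV[R]_d).
Hypothesis mOm : measurable Om.
Notation mu := (@lebesgue_rV R d).
Notation leb := (@lebesgue_measure R).
Variables (I : set R) (f : R -> 'rV[R]_d -> R).
Hypotheses (mI : measurable I) (hf : bochner_square_integrable Om I f).

Lemma measurable_section (k : R * 'rV[R]_d -> R) s : measurable_fun (I `*` Om) k ->
  I s -> measurable_fun Om (fun x => k (s, x)).
Proof.
move=> mk Is; apply: (@measurable_comp _ _ _ _ _ _ (I `*` Om) k Om (pair s)) => //.
- exact: measurableX.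
- by move=> _ [x Omx <-].
- exact: (@measurable_funS _ _ _ _ setT).
Qed.

(** The positive and negative parts are treated by Tonelli's theorem, and a
    difference of measurable extended real functions is measurable even where
    both are infinite. *)
Lemma measurable_integral_section (k : R * 'rV[R]_d -> R) :
    measurable_fun (I `*` Om) k ->
  measurable_fun I (fun s => \int[mu]_(x in Om) (k (s, x))%:E)%E.
Proof.
move=> mk; pose K := (EFin \o k) \_ (I `*` Om).
have mK : measurable_fun setT K.
  by apply/(measurable_restrictT _ _).1; [exact: measurableX|exact/measurable_EFinP].
apply: (@eq_measurable_fun _ _ _ _ _
  (fun s => \int[mu]_x K^\+ (s, x) - \int[mu]_x K^\- (s, x))%E).
  move=> s /set_mem Is; rewrite [RHS]integral_mkcond.
  have -> : (fun x => (k (s, x))%:E) \_ Om = K \o pair s.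
    by apply/funext => x; rewrite /K /patch /= in_setX /= (mem_set Is).
  rewrite [RHS]integralE.
  by congr (_ - _)%E; apply: eq_integral => x _; rewrite ?funepos_comp ?funeneg_comp.
apply: (@measurable_funS _ _ _ _ setT) => //.
apply: emeasurable_funB.
  apply: (measurable_fun_fubini_tonelli_F K^\+%E) => //.
  exact: measurable_funepos.
apply: (measurable_fun_fubini_tonelli_F K^\-%E) => //.
exact: measurable_funeneg.
Qed.

Let F s : \bar R := (\int[mu]_(x in Om) ((f s x) ^+ 2)%:E)%E.

Let F_ge0 s : (0 <= F s)%E.
Proof. by apply: integral_ge0 => x _; rewrite lee_fin sqr_ge0. Qed.

Let mF : measurable_fun I F.
Proof.
apply: (measurable_integral_section (k := fun z => f z.1 z.2 ^+ 2)).
by apply: measurable_funX; case: hf.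
Qed.

Let iF : leb.-integrable I F.
Proof.
apply/integrableP; split=> //; under eq_integral do rewrite gee0_abs//.
by case: hf.
Qed.

Lemma l2norm_sqE s : l2norm Om (f s) ^+ 2 = fine (F s).
Proof.
rewrite /l2norm sqr_sqrtr; last exact: ip_ge0.
by rewrite /ip /Rintegral; congr fine; apply: eq_integral => x _; rewrite -expr2.
Qed.

Lemma forcing_energy_integrable :
  leb.-integrable I (EFin \o (fun s => l2norm Om (f s) ^+ 2)).
Proof.
apply: (@le_integrable _ _ _ leb I mI _ F) => //.
  apply/measurable_EFinP; under eq_fun do rewrite l2norm_sqE.
  exact: (measurableT_comp _ mF).
move=> s Is /=; rewrite l2norm_sqE gee0_abs// ger0_norm ?fine_ge0//.
by case: (F s) (F_ge0 s) => [r| |] //= _; rewrite leey.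
Qed.

Lemma forcing_ae_finite : {ae leb, forall s, I s -> square_integrable Om (f s)}.
Proof.
have := @integrable_ae _ _ _ leb I mI F iF; apply: filterS => s h Is; split.
  by apply: (measurable_section (k := fun z => f z.1 z.2)) => //; case: hf.
by have := h Is; rewrite ge0_fin_numE.
Qed.

Section forcing_le.
Variables (a b : R) (n : nat) (c : 'I_n -> h1fun R d) (w : 'rV[{poly R}]_n).
Hypotheses (ab : a < b) (Iab : `]a, b[ `<=` I) (Lc : forall j, l2pair Om (c j)).
Let W s : h1fun R d := \sum_j (w ord0 j).[s] *: c j.
Let L := l2pair_linear mOm.
Let P := psd_ip mOm.

Let LW s : l2pair Om (W s).
Proof. by apply: linear_space_sum => // j; exact: linear_spaceZ. Qed.

Let hE s x : (W s).1 x = \sum_j (w ord0 j).[s] * (c j).1 x.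
Proof.
rewrite /W; elim/big_ind2 : _ => //=.
by move=> u1 y1 u2 y2 <- <-.
Qed.

Let mh : measurable_fun I (fun s => ip Om (f s) (W s).1).
Proof.
apply: (measurableT_comp (f := @fine R)) => //.
apply: (measurable_integral_section (k := fun z => f z.1 z.2 * (W z.1).1 z.2)).
apply: measurable_funM; first by case: hf.
under eq_fun do rewrite hE.
apply: measurable_sum => j; apply: measurable_funM.
  apply: (@measurable_comp _ _ _ _ _ _ setT (horner (w ord0 j)) _ fst) => //.
    exact: measurable_horner_itv.
  exact: (@measurable_funS _ _ _ _ setT).
have mc : measurable_fun Om (c j).1 by case: (Lc j) => -[].
apply: (measurable_comp mOm _ mc) => [|]; first by move=> _ [z [_ Omz] <-].
exact: (@measurable_funS _ _ _ _ setT).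
Qed.

(** Young's inequality at every time at which f is square-integrable in space,
    that is, at almost every time. *)
Lemma forcing_le dl : 0 < dl ->
  \int[leb]_(s in `]a, b]) ip Om (f s) (W s).1 <=
  dl * pint a b (pform (gram (l2form Om) c) w w) +
  (4 * dl)^-1 * \int[leb]_(s in `]a, b[) l2norm Om (f s) ^+ 2.
Proof.
move=> dl0; set G := gram _ _.
have mab : measurable (`]a, b[%classic : set R) by [].
have mhab : measurable_fun `]a, b[ (fun s => ip Om (f s) (W s).1).
  exact: measurable_funS mh.
have iN : leb.-integrable `]a, b[ (EFin \o horner (pform G w w)).
  exact: integrable_horner.
have ig : leb.-integrable `]a, b[ (EFin \o (fun s => l2norm Om (f s) ^+ 2)).
  by apply: integrableS forcing_energy_integrable.
pose r := fun s : R => dl * (pform G w w).[s] + (4 * dl)^-1 * l2norm Om (f s) ^+ 2.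
have ir : leb.-integrable `]a, b[ (EFin \o r).
  exact: (@integrableD _ _ _ leb _ mab _ _ (@integrableZl _ _ _ leb _ mab dl _ iN)
    (@integrableZl _ _ _ leb _ mab (4 * dl)^-1 _ ig)).
have r0 : forall s, 0 <= r s.
  move=> s; apply: addr_ge0; apply: mulr_ge0.
  - exact: ltW.
  - by rewrite horner_pform; case: (gram_psd L P Lc).
  - by rewrite invr_ge0 mulr_ge0// ltW.
  - exact: sqr_ge0.
have hr : forall s, square_integrable Om (f s) -> `|ip Om (f s) (W s).1| <= r s.
  move=> s Lf; pose fs : h1fun R d := (f s, fun=> 0).
  have Lfs : l2pair Om fs.
    split=> // i; rewrite (_ : (fun _ => _) = fun=> 0) /=.
      exact: square_integrable0.
    by apply/funext => x; rewrite mxE.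
  have -> : r s = dl * l2form Om (W s) (W s) + (4 * dl)^-1 * l2form Om fs fs.
    have WE : \sum_j (peval w s) ord0 j *: c j = W s.
      by apply: eq_bigr => j _; rewrite pevalE.
    have fE : l2norm Om (f s) ^+ 2 = l2form Om fs fs.
      by rewrite /l2norm sqr_sqrtr//; exact: ip_ge0.
    by rewrite /r fE horner_pform -(gramE L P _ _ Lc) WE.
  have key (e : R) : e ^+ 2 = 1 -> - (e * l2form Om fs (W s)) <=
      dl * l2form Om (W s) (W s) + (4 * dl)^-1 * l2form Om fs fs.
    move=> e1; have := psd_ge0 P ((2 * dl * e) *: W s + fs).
    rewrite (psd_sqD L P)//; last exact: (linear_spaceZ _ L (LW s)).
    rewrite (psd_sqZ L P)//.
    have -> : l2form Om ((2 * dl * e) *: W s) fs = 2 * dl * e * l2form Om fs (W s).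
      have := psd_linear P (2 * dl * e) (LW s) L.1 Lfs.
      by rewrite (psd0l L P)// !addr0 (psd_sym P (W s)) => <-.
    rewrite !exprMn e1 mulr1 => h.
    rewrite -subr_ge0 -(pmulr_rge0 _ (_ : 0 < 4 * dl)) ?mulr_gt0//.
    move: h => /le_trans; apply; rewrite le_eqVlt; apply/orP; left; apply/eqP.
    by field; rewrite gt_eqF.
  rewrite -[ip Om _ _]/(l2form Om fs (W s)) ler_norml; apply/andP; split.
    by have := key 1 (expr1n _ _); rewrite mul1r; lra.
  have n1 : (- 1) ^+ 2 = 1 :> R by rewrite sqrrN expr1n.
  by have := key (- 1) n1; rewrite mulN1r opprK.
have hle : (\int[leb]_(s in `]a, b[) `|ip Om (f s) (W s).1|%:E <=
            \int[leb]_(s in `]a, b[) (r s)%:E)%E.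
  apply: ae_ge0_le_integral => //.
  - by apply/measurable_EFinP; exact: (measurableT_comp _ mhab).
  - by move=> s _; rewrite lee_fin.
  - by case/integrableP : ir.
  - have [N [mN N0 NL]] := forcing_ae_finite.
    exists N; split=> //; apply: subset_trans NL => s /= + Ls; apply.
    by move=> /Iab/Ls/hr; rewrite lee_fin.
have roo : (\int[leb]_(s in `]a, b[) (r s)%:E < +oo)%E.
  case/integrableP : ir => _; under eq_integral do rewrite /= ger0_norm//.
  exact.
have ih : leb.-integrable `]a, b[ (EFin \o (fun s => ip Om (f s) (W s).1)).
  apply/integrableP; split; first exact/measurable_EFinP.
  exact: le_lt_trans hle roo.
have -> : \int[leb]_(s in `]a, b]) ip Om (f s) (W s).1 =
          \int[leb]_(s in `]a, b[) ip Om (f s) (W s).1.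
  by rewrite -Rintegral_itv_bndo_bndc.
have -> : dl * pint a b (pform G w w) +
    (4 * dl)^-1 * \int[leb]_(s in `]a, b[) l2norm Om (f s) ^+ 2 =
    \int[leb]_(s in `]a, b[) r s.
  rewrite RintegralD//; last 2 first.
  - exact: (@integrableZl _ _ _ leb _ mab dl _ iN).
  - exact: (@integrableZl _ _ _ leb _ mab (4 * dl)^-1 _ ig).
  by rewrite !RintegralZl// Rintegral_horner.
apply: le_trans (ler_norm _) _; apply: le_trans (le_normr_Rintegral _ ih) _ => //.
apply: fine_le => //.
- rewrite ge0_fin_numE; first exact: le_lt_trans hle roo.
  by apply: integral_ge0.
- rewrite ge0_fin_numE//; apply: integral_ge0 => s _; by rewrite lee_fin.
Qed.

End forcing_le.
End forcing.

(** * Essential suprema on a slab *)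

Section slab_essential_supremum.
Context {R : realType} (t : nat -> R) (n : nat).
Notation leb := (@lebesgue_measure R).
Local Notation a := (t n.-1).
Local Notation b := (t n).
Hypothesis ab : a < b.
Local Notation nu := (mrestr leb (measurable_itv `]t n.-1, t n])).

(** The right end, where time derivatives are meaningless, is negligible. *)
Lemma slab_ae (P : R -> Prop) :
  (\forall s \ae nu, P s) <-> {ae leb, forall s, `]a, b[%classic s -> P s}.
Proof.
split=> -[N [mN N0 NP]].
  exists (N `&` `]a, b]); split => //; first exact: measurableI.
  move=> s /= /not_implyP[sab nP]; split; first exact: NP.
  by move: sab; rewrite /= !in_itv/= => /andP[-> /ltW->].
exists (N `|` ~` `]a, b[); split => //.
- by apply: measurableU => //; exact: measurableC.
- apply/eqP; rewrite eq_le measure_ge0 andbT.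
  rewrite /mrestr setIUl; apply: le_trans (measureU2 _ _ _) _ => //.
  + exact: measurableI.
  + by apply: measurableI => //; exact: measurableC.
  have e1 : leb (N `&` `]a, b]) = 0%E.
    by apply: (subset_measure0 _ mN) => //; exact: measurableI.
  have e2 : leb (~` `]a, b[ `&` `]a, b]) = 0%E.
    apply: (@subset_measure0 _ _ _ leb _ [set b]) => //.
    - by apply: measurableI => //; exact: measurableC.
    - move=> s [/= h1]; rewrite !in_itv/= => /andP[as' sb]; move: h1.
      rewrite in_itv/= as'/= => /negP; rewrite -leNgt => bs.
      by apply/eqP; rewrite eq_le bs sb.
    - exact: lebesgue_measure_set1.
  by rewrite [X in (X + _)%E]e1 [X in (_ + X)%E]e2 adde0.
- move=> s /= nP; have [sab|] := pselect (`]a, b[%classic s); last by right.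
  by left; apply: NP => /= h; exact/nP/h.
Qed.

Let nuT : (0 < nu setT)%E.
Proof.
rewrite /mrestr setTI lebesgue_measure_itv/= lte_fin ab -EFinB lte_fin.
by rewrite subr_gt0.
Qed.

Lemma slab_sup_ge0 (g : R -> R) : (forall s, 0 <= g s) -> (0 <= slab_sup t n g)%E.
Proof.
by move=> g0; apply: ess_sup_gee => //; apply: nearW => s; rewrite lee_fin.
Qed.

Lemma slab_sup_sq_le (g : R -> R) C : (forall s, 0 <= g s) ->
    (forall s, `]a, b[%classic s -> g s ^+ 2 <= C) ->
  (slab_sup t n g ^+ 2 <= C%:E)%E.
Proof.
move=> g0 gC.
have C0 : 0 <= C.
  apply: le_trans (gC ((a + b) / 2) _); first exact: sqr_ge0.
  by rewrite /= in_itv/=; have := ab; move=> h; apply/andP; split; lra.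
have -> : C%:E = ((Num.sqrt C)%:E ^+ 2)%E by rewrite -EFin_expe sqr_sqrtr.
rewrite lee_sqr ?slab_sup_ge0 ?lee_fin ?sqrtr_ge0//.
apply/ess_supP/slab_ae; apply: aeW => s sab.
by rewrite lee_fin -(ger0_norm (g0 s)) -sqrtr_sqr ler_sqrt// gC.
Qed.

Lemma slab_sup_sq_ge (g : R -> R) : (forall s, 0 <= g s) ->
  {ae leb, forall s, `]a, b[%classic s ->
     ((g s ^+ 2)%:E <= slab_sup t n g ^+ 2)%E}.
Proof.
move=> g0; apply/slab_ae; have := ess_sup_ge nu (fun s => (g s)%:E).
apply: filterS => s gs.
by rewrite EFin_expe lee_sqr ?slab_sup_ge0// lee_fin.
Qed.

End slab_essential_supremum.

(** * Time derivatives and traces of piecewise polynomials *)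

Section one_sided_traces.
Context {R : realType} (a b : R) (g : R -> R) (q : {poly R}).
Hypotheses (ab : a < b) (gq : forall s, a < s < b -> g s = q.[s]).

Lemma derive1_eq_horner s : a < s < b -> derive1 g s = (q^`()).[s].
Proof.
move=> sab; rewrite derivE !derive1E; apply: near_eq_derive.
have : s \in `]a, b[%R by rewrite in_itv.
move=> /near_in_itvoo; apply: filterS => r; rewrite in_itv/=; exact: gq.
Qed.

Lemma lim_right_horner : lim (g r @[r --> a^'+]) = q.[a].
Proof.
apply: cvg_lim => //.
apply: cvg_trans (cvg_at_right_filter (@continuous_horner _ q a)).
apply: near_eq_cvg; near=> r; apply/esym/gq/andP; split; near: r.
  exact: nbhs_right_gt.
exact: nbhs_right_lt.
Unshelve. all: by end_near. Qed.

Lemma lim_left_horner : lim (g r @[r --> b^'-]) = q.[b].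
Proof.
apply: cvg_lim => //.
apply: cvg_trans (cvg_at_left_filter (@continuous_horner _ q b)).
apply: near_eq_cvg; near=> r; apply/esym/gq/andP; split; near: r.
  exact: nbhs_left_gt.
exact: nbhs_left_lt.
Unshelve. all: by end_near. Qed.

End one_sided_traces.

Section coordinates.
Context {R : realType} (d n : nat) (fam : 'I_n -> h1fun R d).
Implicit Types (x y : 'rV[R]_n) (w : 'rV[{poly R}]_n).

Definition comb x : h1fun R d := \sum_i x ord0 i *: fam i.

Lemma combB x y : comb (x - y) = comb x - comb y.
Proof.
rewrite /comb -sumrB; apply: eq_bigr => i _.
by rewrite !mxE scalerBl.
Qed.

Lemma h1fun_sum1 (I : finType) (F : I -> h1fun R d) (x : 'rV[R]_d) :
  (\sum_i F i).1 x = \sum_i (F i).1 x.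
Proof. by elim/big_ind2 : _ => //= u1 y1 u2 y2 <- <-. Qed.

Let pointwise w (x : 'rV[R]_d) : {poly R} := \sum_i (fam i).1 x *: w ord0 i.

Let pointwiseE w (s : R) (x : 'rV[R]_d) : (comb (peval w s)).1 x = (pointwise w x).[s].
Proof.
rewrite /comb h1fun_sum1 horner_sum; apply: eq_bigr => i _.
by rewrite hornerZ pevalE mulrC.
Qed.

Let deriv_pointwise w (x : 'rV[R]_d) : (pointwise w x)^`() = pointwise (pderiv w) x.
Proof.
rewrite /pointwise raddf_sum; apply: eq_bigr => i _ /=.
by rewrite derivZ mxE.
Qed.

Variables (a b : R) (g : R -> 'rV[R]_d -> R) (w : 'rV[{poly R}]_n).
Hypotheses (ab : a < b) (gw : forall s, a < s < b -> g s = (comb (peval w s)).1).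

Lemma dt_comb s : a < s < b -> dt g s = (comb (peval (pderiv w) s)).1.
Proof.
move=> sab; apply/funext => x; rewrite pointwiseE -deriv_pointwise.
by apply: (derive1_eq_horner _ sab) => r rab; rewrite -pointwiseE gw.
Qed.

Lemma rtrace_comb : rtrace g a = (comb (peval w a)).1.
Proof.
apply/funext => x; rewrite pointwiseE; apply: (lim_right_horner ab) => r rab.
by rewrite -pointwiseE gw.
Qed.

Lemma ltrace_comb : ltrace g b = (comb (peval w b)).1.
Proof.
apply/funext => x; rewrite pointwiseE; apply: (lim_left_horner ab) => r rab.
by rewrite -pointwiseE gw.
Qed.

End coordinates.

(** * The method on one slab *)

Section slab.
Context {R : realType} (d : nat) (Om : set 'rV[R]_d).
Hypothesis oOm : open Om.
Notation leb := (@lebesgue_measure R).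
Variables (V : set (h1fun R d)).
Hypotheses (VL : linear_space V) (VS : V `<=` l2pair Om).
Variables (t : nat -> R) (n p : nat).
Local Notation a := (t n.-1).
Local Notation b := (t n).
Hypotheses (ab : a < b) (p_gt0 : (0 < p)%N).
Variables (c : 'I_p.+1 -> h1fun R d) (z : h1fun R d) (U : R -> h1fun R d).
Hypotheses (Vc : forall k, V (c k)) (Vz : V z).
Hypothesis Uc : forall s, slab t n s -> U s = \sum_(k < p.+1) s ^+ k *: c k.

Let mOm : measurable Om. Proof. exact: open_measurable_rV. Qed.
Let L := l2pair_linear mOm.
Let PG := psd_ip mOm.
Let PA := psd_h1form mOm.

(** The coefficients of U on the slab together with the incoming velocity: all
    functions that enter the method on the slab are combinations of these, with
    coefficients polynomial in time. *)
Definition slab_family (i : 'I_p.+2) : h1fun R d :=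
  if (i <= p)%N then c (inord i) else z.
Definition slab_coords : 'rV[{poly R}]_p.+2 :=
  \row_i (if (i <= p)%N then 'X^i else 0).
Definition incoming : 'rV[R]_p.+2 := delta_mx ord0 ord_max.

Local Notation fam := slab_family.
Local Notation u := slab_coords.
Local Notation u' := (pderiv u).
Local Notation u'' := (pderiv (pderiv u)).
Local Notation zv := incoming.
Local Notation G := (gram (l2form Om) fam).
Local Notation A := (gram (form Om) fam).
Local Notation cmb := (comb fam).

Let Vfam i : V (fam i).
Proof. by rewrite /slab_family; case: ifP. Qed.

Let Lfam i : l2pair Om (fam i).
Proof. exact: VS. Qed.

Let Vcmb x : V (cmb x).
Proof. by apply: linear_space_sum => // i; exact: linear_spaceZ. Qed.

Lemma slab_G_psd : psd G. Proof. exact: (gram_psd L PG). Qed.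
Lemma slab_A_psd : psd A. Proof. exact: (gram_psd L PA). Qed.

Lemma l2form_cmb x y : l2form Om (cmb x) (cmb y) = gform G x y.
Proof. exact: (gramE L PG). Qed.

Lemma form_cmb x y : form Om (cmb x) (cmb y) = gform A x y.
Proof. exact: (gramE L PA). Qed.

Lemma cmb_incoming : cmb zv = z.
Proof.
rewrite /comb (bigD1 ord_max)//= big1 ?addr0.
  by rewrite mxE !eqxx scale1r /slab_family/= ltnn.
by move=> i im; rewrite mxE (negbTE im) andbF scale0r.
Qed.

Lemma cmb_slab s : cmb (peval u s) = \sum_(k < p.+1) s ^+ k *: c k.
Proof.
rewrite /comb big_ord_recr/= pevalE !mxE/= ltnn horner0 scale0r addr0.
apply: eq_bigr => k _; rewrite pevalE mxE/= -ltnS ltn_ord hornerXn.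
by rewrite /slab_family/= -ltnS ltn_ord inord_val.
Qed.

Lemma size_slab_coords : psize p.+1 u.
Proof.
move=> j; rewrite mxE; case: ifP => jp; last by rewrite size_poly0.
by rewrite size_polyXn ltnS.
Qed.

Lemma slab_value s : a < s <= b -> U s = cmb (peval u s).
Proof. by move=> sab; rewrite cmb_slab Uc//= /slab/= in_itv. Qed.

Lemma velE s : a < s < b -> vel U s = (cmb (peval u' s)).1.
Proof.
apply: (dt_comb (w := u)) => // r /andP[ar rb].
by rewrite slab_value ?ar ?ltW.
Qed.

Lemma dt_velE s : a < s < b -> dt (vel U) s = (cmb (peval u'' s)).1.
Proof. by apply: (dt_comb (w := u')) => // r; exact: velE. Qed.

Lemma rtrace_velE : rtrace (vel U) a = (cmb (peval u' a)).1.
Proof. by apply: (rtrace_comb ab) => r; exact: velE. Qed.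

Lemma ltrace_velE : ltrace (vel U) b = (cmb (peval u' b)).1.
Proof. by apply: (ltrace_comb ab) => r; exact: velE. Qed.

(** Collecting powers of time instead of members of the family; the coefficients
    stay in V because V is linear. *)
Lemma poly_in_time_cmb w : psize p w ->
  poly_in_time p.-1 (slab t n) V (fun s => cmb (peval w s)).
Proof.
move=> sw; exists (fun k : 'I_p.-1.+1 => \sum_i (w ord0 i)`_k *: fam i).
  by move=> k; apply: linear_space_sum => // i; exact: linear_spaceZ.
move=> s _; under eq_bigr do rewrite scaler_sumr.
rewrite exchange_big; apply: eq_bigr => i _ /=.
rewrite pevalE (@horner_coef_wide _ p.-1.+1) ?prednK// scaler_suml.
by apply: eq_bigr => k _; rewrite scalerA mulrC.
Qed.

Section method_equation.
Variables (f : R -> 'rV[R]_d -> R) (J : 'rV[R]_d -> R) (I : set R).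
Hypotheses (mI : measurable I) (hf : bochner_square_integrable Om I f).
Hypothesis Iab : `]a, b[ `<=` I.
Hypothesis JE : J = rtrace (vel U) a \- z.1.
Hypothesis hM : forall W, poly_in_time p.-1 (slab t n) V W ->
  \int[leb]_(s in slab t n)
    (ip Om (dt (vel U) s) (W s).1 + form Om (U s) (W s)) +
  ip Om J (rtrace (fun s => (W s).1) a) =
  \int[leb]_(s in slab t n) ip Om (f s) (W s).1.

Let jmp := peval u' a - zv.

Let Jcmb : J = (cmb jmp).1.
Proof. by rewrite JE rtrace_velE combB cmb_incoming. Qed.

Lemma jump_sqE : l2norm Om J ^+ 2 = gform G jmp jmp.
Proof.
rewrite /l2norm sqr_sqrtr; last exact: ip_ge0.
by rewrite -l2form_cmb /l2form Jcmb.
Qed.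

(** Inside the slab the integrand of the method is the polynomial of the
    residual; the right end is negligible. *)
Lemma residualE w : psize p w ->
  residual G A u zv a b w =
  \int[leb]_(s in `]a, b]) ip Om (f s) (cmb (peval w s)).1.
Proof.
move=> sw; have := hM (poly_in_time_cmb sw).
rewrite /slab => <-; rewrite /residual; congr (_ + _).
  set Q := _ + _ : {poly R}.
  have QE (s : R) : a < s < b -> ip Om (dt (vel U) s) (cmb (peval w s)).1 +
      form Om (U s) (cmb (peval w s)) = Q.[s].
    move=> sab; rewrite dt_velE// hornerD !horner_pform -l2form_cmb -form_cmb.
    by rewrite -slab_value//; case/andP: sab => -> /ltW.
  rewrite -Rintegral_horner// /Rintegral; congr fine.
  rewrite (@integral_itv_bndoo _ _ _ _ false false).
    by apply: eq_integral => s /set_mem; rewrite /= in_itv/= => /QE ->.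
  apply: (@eq_measurable_fun _ _ _ _ _ (fun s => (Q.[s])%:E)).
    by move=> s /set_mem; rewrite /= in_itv/= => /QE ->.
  by apply/measurable_EFinP; exact: measurable_horner_itv.
rewrite (rtrace_comb (fam := slab_family) (w := w) ab)// Jcmb -/(l2form Om (cmb jmp) _).
by rewrite l2form_cmb.
Qed.

Let gI := \int[leb]_(s in `]a, b[) l2norm Om (f s) ^+ 2.
Let Qv := pint a b (pform G u' u').

Let residual_le w dl : psize p w -> 0 < dl ->
  residual G A u zv a b w <= dl * pint a b (pform G w w) + (4 * dl)^-1 * gI.
Proof.
move=> sw dl0; rewrite residualE//.
have cE s : cmb (peval w s) = \sum_j (w ord0 j).[s] *: fam j.
  by apply: eq_bigr => j _; rewrite pevalE.
under eq_Rintegral do rewrite cE.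
exact: (forcing_le mOm mI hf w ab Iab Lfam dl0).
Qed.

Let start := 2^-1 * (l2form Om z z + form Om (cmb (peval u a)) (cmb (peval u a))).

Lemma slab_standard dl : 0 < dl ->
  2^-1 * (l2form Om (cmb (peval u' b)) (cmb (peval u' b)) + form Om (U b) (U b)) +
    2^-1 * l2norm Om J ^+ 2 <= start + dl * Qv + (4 * dl)^-1 * gI.
Proof.
move=> dl0; rewrite /start slab_value ?lexx ?ab// -cmb_incoming.
rewrite !l2form_cmb !form_cmb jump_sqE.
rewrite (residual_velocity u zv a b slab_G_psd slab_A_psd) -addrA lerD2l.
apply: residual_le => // j.
by rewrite mxE (leq_trans (size_deriv_pred _))//; have := size_slab_coords j; case: size.
Qed.

Lemma slab_weighted dl : 0 < dl ->
  (48 * p%:R * (b - a))^-1 * pint a b (pform G u' u' + pform A u u) +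
    4^-1 * l2norm Om J ^+ 2 <= start + dl * Qv + (4 * dl)^-1 * gI.
Proof.
move=> dl0; rewrite /start -cmb_incoming !l2form_cmb !form_cmb jump_sqE.
have [w [sw wle h]] :=
  weighted_test zv slab_G_psd slab_A_psd ab p_gt0 size_slab_coords.
apply: le_trans h _; rewrite -addrA lerD2l.
apply: le_trans (residual_le sw dl0) _; rewrite lerD2r.
by rewrite ler_wpM2l// ltW.
Qed.

End method_equation.

Let Q := pint a b (pform G u' u' + pform A u u).

Lemma slab_energy_ge0 : (0 <= slab_energy Om t U n)%E.
Proof. by rewrite adde_ge0// sqre_ge0. Qed.

(** Each supremum is bounded by the inverse estimate for polynomials of degree at
    most p. *)
Lemma slab_energy_le :
  (slab_energy Om t U n <= (2 * p.+1%:R ^+ 2 / (b - a) * Q)%:E)%E.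
Proof.
rewrite /Q pintD mulrDr EFinD; apply: leeD; apply: slab_sup_sq_le => //.
- by move=> s; exact: sqrtr_ge0.
- move=> s; rewrite /= in_itv/= => sab.
  rewrite /l2norm sqr_sqrtr; last exact: ip_ge0.
  rewrite velE// -/(l2form Om _ _) l2form_cmb.
  apply: inverse_estimate => //; first exact: slab_G_psd.
    move=> j; rewrite mxE (leq_trans (size_deriv_pred _))//.
    by rewrite (leq_trans (leq_pred _))// size_slab_coords.
  by case/andP: sab => /ltW -> /ltW ->.
- by move=> s; exact: sqrtr_ge0.
- move=> s; rewrite /= in_itv/= => sab.
  rewrite /h1seminorm sqr_sqrtr; last exact: (psd_ge0 PA).
  rewrite slab_value; last by case/andP: sab => -> /ltW.
  rewrite form_cmb; apply: inverse_estimate => //; first exact: slab_A_psd.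
    exact: size_slab_coords.
  by case/andP: sab => /ltW -> /ltW ->.
Qed.

Lemma slab_energy_fin : slab_energy Om t U n \is a fin_num.
Proof.
by rewrite ge0_fin_numE ?slab_energy_ge0// (le_lt_trans slab_energy_le) ?ltry.
Qed.

(** The essential supremum bounds the velocity at almost every time. *)
Lemma slab_velocity_le :
  pint a b (pform G u' u') <= (b - a) * fine (slab_energy Om t U n).
Proof.
set X := fine _; have XE : (X%:E = slab_energy Om t U n)%E by rewrite fineK ?slab_energy_fin.
have X0 : 0 <= X by rewrite fine_ge0// slab_energy_ge0.
have q0 (s : R) : 0 <= (pform G u' u').[s].
  by rewrite horner_pform; case: slab_G_psd.
rewrite -Rintegral_horner//.
have -> : (b - a) * X = \int[leb]_(s in `]a, b[) X.
  rewrite Rintegral_cst//= lebesgue_measure_itv/= lte_fin ab /=.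
  by rewrite mulrC.
have mq : measurable_fun `]a, b[ (EFin \o horner (pform G u' u')).
  by apply/measurable_EFinP; exact: measurable_horner_itv.
have iq : leb.-integrable `]a, b[ (EFin \o horner (pform G u' u')).
  exact: integrable_horner.
have iX : leb.-integrable `]a, b[ (EFin \o (fun=> X)).
  have -> : (fun=> X) = horner (X%:P) by apply/funext => s; rewrite hornerC.
  exact: integrable_horner.
apply: fine_le.
- exact: (@integrable_fin_num _ _ _ leb).
- exact: (@integrable_fin_num _ _ _ leb).
apply: ae_ge0_le_integral => //.
- by move=> s _; rewrite lee_fin.
have := @slab_sup_sq_ge _ t n ab (fun s => l2norm Om (vel U s)) (fun s => sqrtr_ge0 _).
move=> [N [mN N0 NP]]; exists N; split=> //; apply: subset_trans NP => s /=.
apply: contra_not => h sab; have := h sab.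
rewrite XE => {}h; apply: le_trans (le_trans h _); last first.
  by rewrite /slab_energy; apply: leeDl; exact: sqre_ge0.
move: sab; rewrite in_itv/= => sab.
rewrite lee_fin /l2norm sqr_sqrtr; last exact: ip_ge0.
by rewrite horner_pform -l2form_cmb /l2form velE.
Qed.

(** U is continuous in time for the norm of H^1 only, and its value z at the
    node belongs to the previous slab. The squared distance to it is a polynomial in
    time that tends to 0 at the node, hence vanishes there, and so does its
    elastic part. *)
Lemma left_value : h1norm Om (U r - z) @[r --> a^'+] --> 0 ->
  form Om (cmb (peval u a)) (cmb (peval u a)) = form Om z z.
Proof.
move=> Uz; have P := psd_h1 oOm.
pose H := gram (h1form Om) fam; pose q := pform H (u - pconst zv) (u - pconst zv).
have qE (r : R) : q.[r] = h1form Om (cmb (peval u r) - z) (cmb (peval u r) - z).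
  rewrite /q horner_pform -(gramE L P)// -[\sum_i _]/(cmb _).
  have -> : peval (u - pconst zv) r = peval u r - zv.
    by apply/matrixP => i j; rewrite !mxE /horner_eval hornerD hornerN hornerC.
  by rewrite combB cmb_incoming.
have qa : q.[a] = 0.
  rewrite -(lim_right_horner (g := fun r => h1norm Om (U r - z) ^+ 2) ab).
    apply: cvg_lim => //; rewrite -[0](mulr0 0).
    by under eq_fun do rewrite expr2; exact: cvgM.
  move=> r rab; rewrite slab_value; last by case/andP: rab => -> /ltW.
  by rewrite (h1normE oOm) sqr_sqrtr ?qE//; exact: (psd_ge0 P).
apply: (psd_null L PA) => //; try exact: VS.
apply/eqP; rewrite eq_le (psd_ge0 PA) andbT -qa qE /h1form lerDr.
exact: (psd_ge0 PG).
Qed.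

End slab.

(** * Time stepping *)

Section time_stepping.
Context {R : realType} (d : nat) (Om : set 'rV[R]_d).
Hypothesis oOm : open Om.
Notation leb := (@lebesgue_measure R).
Variables (V : set (h1fun R d)).
Hypotheses (VL : linear_space V) (VS : V `<=` l2pair Om).
Variables (T : R) (N : nat) (t : nat -> R) (pt : nat -> nat).
Hypothesis ht : time_grid T N t.
Hypothesis hpt : forall n, (1 <= n <= N)%N -> (2 <= pt n)%N.
Variables (f : R -> 'rV[R]_d -> R) (u0h u1h : h1fun R d) (U : R -> h1fun R d).
Hypothesis hf : bochner_square_integrable Om `]0, T[ f.
Hypothesis hU : method_solution Om V T N t pt f u0h u1h U.
Hypothesis Vu1h : V u1h.

Let mOm : measurable Om. Proof. exact: open_measurable_rV. Qed.

Lemma grid_le i j : (i <= j <= N)%N -> t i <= t j.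
Proof.
case: ht => _ _ tS /andP[]; elim: j => [|j IH].
  by rewrite leqn0 => /eqP->.
rewrite leq_eqVlt => /predU1P[->//|]; rewrite ltnS => ij jN.
by apply: le_trans (IH ij (ltnW jN)) _; apply: ltW; exact: tS.
Qed.

Lemma grid_lt n : (1 <= n <= N)%N -> t n.-1 < t n.
Proof. by case: ht => _ _ tS; case: n => // n /andP[_ nN]; exact: tS. Qed.

Lemma grid_ge0 n : (n <= N)%N -> 0 <= t n.
Proof. by move=> nN; have [<- _ _] := ht; exact: grid_le. Qed.

Lemma grid_leT n : (n <= N)%N -> t n <= T.
Proof. by move=> nN; have [_ <- _] := ht; apply: grid_le; rewrite nN leqnn. Qed.

Lemma pred_leN n : (1 <= n <= N)%N -> (n.-1 <= N)%N.
Proof. by move=> /andP[_ nN]; exact: leq_trans (leq_pred _) nN. Qed.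

Definition left_velocity n : 'rV[R]_d -> R :=
  if n == 0%N then u1h.1 else ltrace (vel U) (t n).

Definition node_energy n (z : h1fun R d) : R :=
  2^-1 * (l2form Om z z + form Om (U (t n)) (U (t n))).

Definition slab_force n : R := \int[leb]_(s in `]t n.-1, t n[) l2norm Om (f s) ^+ 2.

Lemma node_continuity n : (1 <= n <= N)%N ->
  h1norm Om (U r - U (t n.-1)) @[r --> (t n.-1)^'+] --> 0.
Proof.
move=> nN; have [[_ cU _ _] _] := hU.
have tn : t n.-1 \in `[0, T].
  by rewrite in_itv/= grid_ge0 ?grid_leT ?pred_leN.
apply: cvg_trans (cU _ tn) => P /=.
rewrite /nbhs /= /fmap /= => h.
have lt := grid_lt nN.
have : \forall r \near (t n.-1)^'+, `[0, T]%classic r.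
  near=> r; rewrite /= in_itv/=; apply/andP; split.
    by rewrite (le_trans (grid_ge0 (pred_leN nN)))//; near: r; exact: nbhs_right_ge.
  apply: (@le_trans _ _ (t n)); last by apply: grid_leT; case/andP: nN.
  by near: r; exact: nbhs_right_le.
move: h; rewrite /at_right /within /= => h1 h2.
apply: filterS2 h1 h2 => r h1 h2 r0.
exact/h1/h2.
Unshelve. all: by end_near. Qed.

(** Only the values of the incoming velocity are determined by U. It is
    represented by an element z of V with these values, because the energies of
    the slab are computed in V; z' plays this role for the next slab. Q and Qv
    stand for the integrals over the slab of the energy and of its kinetic
    part. *)
Lemma slab_step n z : (1 <= n <= N)%N -> V z -> z.1 = left_velocity n.-1 ->
  exists z' Q Qv, [/\ V z', z'.1 = left_velocity n,
    (0 <= slab_energy Om t U n)%E /\ slab_energy Om t U n \is a fin_num,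
    fine (slab_energy Om t U n) <=
      2 * (pt n).+1%:R ^+ 2 / (t n - t n.-1) * Q /\
    Qv <= (t n - t n.-1) * fine (slab_energy Om t U n) &
    forall dl, 0 < dl ->
      node_energy n z' + 2^-1 * l2norm Om (jump t U u1h n) ^+ 2 <=
        node_energy n.-1 z + dl * Qv + (4 * dl)^-1 * slab_force n /\
      (48 * (pt n)%:R * (t n - t n.-1))^-1 * Q +
        4^-1 * l2norm Om (jump t U u1h n) ^+ 2 <=
        node_energy n.-1 z + dl * Qv + (4 * dl)^-1 * slab_force n].
Proof.
move=> nN Vz zE; have ab := grid_lt nN.
have [[VU cU U0 pU] hM] := hU.
have p2 := hpt nN; have p0 : (0 < pt n)%N by exact: ltnW.
have [c Vc Uc] := pU n nN.
have VUa : V (U (t n.-1)).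
  by apply: VU; rewrite in_itv/= grid_ge0 ?grid_leT ?pred_leN.
have UaE : form Om (comb (slab_family c z) (peval (slab_coords (pt n)) (t n.-1)))
     (comb (slab_family c z) (peval (slab_coords (pt n)) (t n.-1))) =
   form Om (U (t n.-1)) (U (t n.-1)).
  rewrite cmb_slab -(cmb_slab c (U (t n.-1))).
  exact: (left_value oOm VL VS ab Vc VUa Uc (node_continuity nN)).
have JE : jump t U u1h n = rtrace (vel U) (t n.-1) \- z.1.
  rewrite zE /jump /left_velocity; move: nN => /andP[n1 _].
  by case: (n) n1 => [|[|k]].
have Iab : `]t n.-1, t n[ `<=` `]0, T[.
  apply: subset_itv; rewrite bnd_simp; first by rewrite grid_ge0// pred_leN.
  by apply: grid_leT; case/andP: nN.
pose G := gram (l2form Om) (slab_family c z).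
pose A := gram (form Om) (slab_family c z).
pose u := slab_coords (R := R) (pt n).
exists (comb (slab_family c z) (peval (pderiv u) (t n))).
exists (pint (t n.-1) (t n) (pform G (pderiv u) (pderiv u) + pform A u u)).
exists (pint (t n.-1) (t n) (pform G (pderiv u) (pderiv u))).
split.
- apply: linear_space_sum => // i; apply: linear_spaceZ => //.
  by rewrite /slab_family; case: ifP.
- rewrite -(ltrace_velE ab z Uc) /left_velocity.
  by case: eqP nN => // ->.
- split; first exact: slab_energy_ge0.
  exact: (slab_energy_fin oOm VS ab Vc Vz Uc).
- split; last exact: (slab_velocity_le oOm VS ab Vc Vz Uc).
  rewrite -lee_fin fineK; last exact: (slab_energy_fin oOm VS ab Vc Vz Uc).
  exact: (slab_energy_le oOm VS ab Vc Vz Uc).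
move=> dl dl0.
have h1 := @slab_standard _ _ _ oOm _ VL VS _ _ _ ab p0
   _ _ _ Vc Vz Uc f _ _ (measurable_itv _) hf Iab JE
   (fun W hW => hM n W nN hW) dl dl0.
have h2 := @slab_weighted _ _ _ oOm _ VL VS _ _ _ ab p0
   _ _ _ Vc Vz Uc f _ _ (measurable_itv _) hf Iab JE
   (fun W hW => hM n W nN hW) dl dl0.
by move: h1 h2; rewrite UaE.
Qed.

Let iF := forcing_energy_integrable mOm (measurable_itv _) hf.

(** The slabs without their nodes are disjoint subsets of the interval from 0 to
    t m. *)
Lemma sum_slab_force m : (m <= N)%N ->
  \sum_(1 <= k < m.+1) slab_force k <= bochner_norm Om `]0, t m[ f ^+ 2.
Proof.
move=> mN; rewrite /bochner_norm sqr_sqrtr; last first.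
  by apply: Rintegral_ge0 => s _; exact: sqr_ge0.
elim: m mN => [|m IH] mN.
  by rewrite big_nil; apply: Rintegral_ge0 => s _; exact: sqr_ge0.
have m1 : (1 <= m.+1 <= N)%N by [].
rewrite big_nat_recr//= /slab_force /=.
apply: le_trans (lerD (IH (ltnW mN)) (lexx _)) _.
have tm := grid_lt m1; have tm0 : 0 <= t m := grid_ge0 (ltnW mN).
have mU : measurable ((`]0, t m[ `|` `]t m, t m.+1[)%classic : set R) by exact: measurableU.
have iU : leb.-integrable (`]0, t m[ `|` `]t m, t m.+1[)
    (EFin \o (fun s => l2norm Om (f s) ^+ 2)).
  apply: (@integrableS _ _ _ leb `]0, T[) => //.
  move=> s [] /=; rewrite !in_itv/= => /andP[h1 h2]; apply/andP; split.
  - exact: h1.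
  - by apply: lt_le_trans h2 _; exact: grid_leT (ltnW mN).
  - exact: le_lt_trans tm0 h1.
  - by apply: lt_le_trans h2 _; exact: grid_leT.
rewrite -Rintegral_setU//; last first.
  apply/disj_setPS => s [] /=; rewrite !in_itv/= => /andP[_ h1] /andP[h2 _].
  by have := lt_trans h1 h2; rewrite ltxx.
have i1 : leb.-integrable `]0, t m.+1[ (EFin \o (fun s => l2norm Om (f s) ^+ 2)).
  apply: (@integrableS _ _ _ leb `]0, T[) => //.
  by apply: subset_itvl; rewrite bnd_simp; exact: grid_leT.
apply: fine_le.
- exact: (@integrable_fin_num _ _ _ leb _ mU _ iU).
- exact: (@integrable_fin_num _ _ _ leb _ (measurable_itv _) _ i1).
apply: ge0_subset_integral => //.
- by case/integrableP : i1.
- by move=> s _; rewrite lee_fin sqr_ge0.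
move=> s [] /=; rewrite !in_itv/= => /andP[h1 h2]; apply/andP; split=> //.
  exact: lt_trans h2 tm.
exact: le_lt_trans tm0 h1.
Qed.

Section bounded_energy.
Variables (X dl : R).
Hypotheses (dl_gt0 : 0 < dl).
Hypothesis XP : forall k, (1 <= k <= N)%N -> fine (slab_energy Om t U k) <= X.

Let Qv_le k Qv : (1 <= k <= N)%N ->
  Qv <= (t k - t k.-1) * fine (slab_energy Om t U k) ->
  dl * Qv <= dl * (X * (t k - t k.-1)).
Proof.
move=> kN h; apply: ler_wpM2l; first exact: ltW.
apply: le_trans h _; rewrite mulrC ler_wpM2r ?XP// subr_ge0 ltW//.
exact: grid_lt.
Qed.

Let add_standard (e e' J dq i F S E0 SF c0 c1 cd : R) :
  e' + 2^-1 * J <= e + dq + i * F -> e + 2^-1 * S <= E0 + c0 + i * SF ->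
  dq <= cd -> c0 + cd = c1 -> e' + 2^-1 * (S + J) <= E0 + c1 + i * (SF + F).
Proof. by move=> h1 h2 h3 h4; lra. Qed.

Let add_weighted (e q J dq i F S E0 SF c0 c1 cd : R) : 0 <= S ->
  q + 4^-1 * J <= e + dq + i * F -> e + 2^-1 * S <= E0 + c0 + i * SF ->
  dq <= cd -> c0 + cd = c1 -> q + 4^-1 * (S + J) <= E0 + c1 + i * (SF + F).
Proof. by move=> h0 h1 h2 h3 h4; lra. Qed.

Let split_node k : dl * (X * t k) + dl * (X * (t k.+1 - t k)) = dl * (X * t k.+1).
Proof. by ring. Qed.

(** Induction over the slabs, whose kinetic energies are at most X. *)
Lemma standard_sum n : (n <= N)%N -> exists z, [/\ V z, z.1 = left_velocity n &
  node_energy n z + 2^-1 * \sum_(1 <= k < n.+1) l2norm Om (jump t U u1h k) ^+ 2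
  <= node_energy 0 u1h + dl * (X * t n) +
     (4 * dl)^-1 * \sum_(1 <= k < n.+1) slab_force k].
Proof.
elim: n => [|n IH] nN.
  exists u1h; split=> //; rewrite !big_nil !mulr0 !addr0 lerDl.
  by case: ht => -> _ _; rewrite !mulr0.
have [z [Vz zE zle]] := IH (ltnW nN).
have n1 : (1 <= n.+1 <= N)%N by [].
have [z' [Q [Qv [Vz' zE' _ [_ Qvle]] /(_ dl dl_gt0)[step _]]]] := slab_step n1 Vz zE.
exists z'; split=> //; rewrite !(@big_nat_recr _ _ _ n.+1)//.
exact: add_standard step zle (Qv_le n1 Qvle) (split_node n).
Qed.

(** The velocity is the test function on the slabs before the last one, where the
    weighted test function is used. *)
Lemma stability_sum m : (1 <= m <= N)%N -> exists Q,
  fine (slab_energy Om t U m) <=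
    2 * (pt m).+1%:R ^+ 2 / (t m - t m.-1) * Q /\
  (48 * (pt m)%:R * (t m - t m.-1))^-1 * Q +
    4^-1 * \sum_(1 <= k < m.+1) l2norm Om (jump t U u1h k) ^+ 2 <=
  node_energy 0 u1h + dl * (X * t m) +
    (4 * dl)^-1 * \sum_(1 <= k < m.+1) slab_force k.
Proof.
case: m => // m mN; have [z [Vz zE zle]] := standard_sum (pred_leN mN).
have [z' [Q [Qv [_ _ _ [Qle Qvle]] /(_ dl dl_gt0)[_ step]]]] := slab_step mN Vz zE.
exists Q; split=> //.
have h := Qv_le mN Qvle.
rewrite !(@big_nat_recr _ _ _ m.+1)//.
have J0 : 0 <= \sum_(1 <= k < m.+1) l2norm Om (jump t U u1h k) ^+ 2.
  by apply: sumr_ge0 => k _; exact: sqr_ge0.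
exact: add_weighted J0 step zle h (split_node m).
Qed.

End bounded_energy.

End time_stepping.

(** * The stability bound *)

Section stability_constant.
Context {R : realType}.
Variable P : R.
Hypothesis P2 : 2 <= P.

Let P0 : 0 < P. Proof. by move: P2; lra. Qed.

Let den_gt0 : 0 < 1024 * P ^+ 2 * (2 * P + 1).
Proof.
apply: mulr_gt0; first by apply: mulr_gt0; [rewrite ltr0n|exact: exprn_gt0].
by move: P2; lra.
Qed.

Lemma stability_constant_gt0 : 0 < 1 / (1024 * P ^+ 2 * (2 * P + 1)).
Proof. by rewrite div1r invr_gt0. Qed.

(** In terms of Q / tau this reduces to 192 P (P + 1)^2 <= 1024 P^2 (2 P + 1),
    where 192 = 2 * 2 * 48 collects the inverse estimate and the weight. *)
Lemma stability_constant_le (X Q tau : R) : 0 < tau -> 0 <= X ->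
    X <= 2 * (P + 1) ^+ 2 / tau * Q ->
  2 * (1 / (1024 * P ^+ 2 * (2 * P + 1))) * X <= (48 * P * tau)^-1 * Q.
Proof.
move=> tau0 X0; set Y := Q / tau.
have -> : 2 * (P + 1) ^+ 2 / tau * Q = 2 * (P + 1) ^+ 2 * Y by rewrite /Y; ring.
have -> : (48 * P * tau)^-1 * Q = Y / (48 * P).
  by rewrite /Y; field; rewrite !gt_eqF.
move=> XY.
have c0 : 0 < 2 * (P + 1) ^+ 2.
  by apply: mulr_gt0 => //; apply: exprn_gt0; move: P2; lra.
have Y0 : 0 <= Y by rewrite -(pmulr_rge0 _ c0); exact: le_trans XY.
have -> : 2 * (1 / (1024 * P ^+ 2 * (2 * P + 1))) * X =
    2 * X / (1024 * P ^+ 2 * (2 * P + 1)) by ring.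
rewrite ler_pdivrMr// mulrAC ler_pdivlMr ?mulr_gt0//.
have h1 : 192 * P * (P + 1) ^+ 2 <= 1024 * P ^+ 2 * (2 * P + 1).
  have : 0 <= P * (P - 2) by apply: mulr_ge0; [exact: ltW|rewrite subr_ge0].
  have : 0 <= P * P * (P - 2).
    by apply: mulr_ge0; [apply: mulr_ge0; exact: ltW|rewrite subr_ge0].
  by rewrite !expr2; move: P2; lra.
apply: (@le_trans _ _ (192 * P * (P + 1) ^+ 2 * Y)).
  have := ler_wpM2l (ltW P0) XY; lra.
by rewrite [Y * _]mulrC; apply: ler_wpM2r.
Qed.

End stability_constant.

Theorem theorem2p1 (R : realType) (d : nat) (hd : (1 <= d <= 3)%N)
  (Om : set 'rV[R]_d) (hOm : polytopic_lipschitz_domain Om)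
  (T : R) (hT : 0 < T)
  (u0 : h1fun R d) (hu0 : sobolev10 Om u0)
  (u1 : 'rV[R]_d -> R) (hu1 : square_integrable Om u1)
  (f : R -> 'rV[R]_d -> R) (hf : bochner_square_integrable Om `]0, T[ f)
  (ct : cell_type) (K : mesh d ct) (hK : conforming_mesh Om K)
  (h : R) (hh : h = mesh_size K)
  (gamma : R) (hgamma : 0 < gamma < 1) (hKgamma : regular_mesh K gamma)
  (px : nat) (hpx : (1 <= px)%N)
  (N : nat) (t : nat -> R) (ht : time_grid T N t)
  (pt : nat -> nat) (hpt : forall n, (1 <= n <= N)%N -> (2 <= pt n)%N)
  (u0h : h1fun R d) (hu0h : elliptic_projection Om (fe_space Om K px) u0 u0h)
  (u1h : h1fun R d) (hu1h : l2_projection Om (fe_space Om K px) u1 u1h)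
  (U : R -> h1fun R d)
  (hU : method_solution Om (fe_space Om K px) T N t pt f u0h u1h U)
  (m : nat) (hm : (1 <= m <= N)%N)
  (hmax : slab_energy Om t U m =
    \big[maxe/-oo%E]_(1 <= n < N.+1) slab_energy Om t U n)
  (mu_m : R)
  (hmu_m : mu_m = 1 / (1024 * (pt m)%:R ^+ 2 * (2 * (pt m)%:R + 1))) :
  (mu_m%:E * slab_energy Om t U m +
   (1 / 4 * \sum_(1 <= n < m.+1) l2norm Om (jump t U u1h n) ^+ 2)%:E <=
   (1 / 2 * (h1seminorm Om u0 ^+ 2 + l2norm Om u1 ^+ 2) +
    t m / mu_m * bochner_norm Om `]0, t m[ f ^+ 2)%:E)%E.
Proof.
have [[_ oOm _ bOm] _] := hOm.
have mOm := open_measurable_rV oOm.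
pose V := fe_space Om K px.
have VL : linear_space V by exact: fe_space_linear.
have VS : V `<=` l2pair Om by exact: fe_space_l2pair.
have L := l2pair_linear mOm; have PG := psd_ip mOm; have PA := psd_h1form mOm.
have [Vu0h e0] := hu0h; have [Vu1h e1] := hu1h.
have fin n : (1 <= n <= N)%N -> slab_energy Om t U n \is a fin_num.
  move=> nN; have [[_ _ _ pU] _] := hU; have [c Vc Uc] := pU n nN.
  exact: (slab_energy_fin oOm VS (grid_lt ht nN) Vc Vu1h Uc).
set X := fine (slab_energy Om t U m).
have XE : slab_energy Om t U m = X%:E by rewrite fineK// fin.
have X0 : 0 <= X by rewrite fine_ge0// slab_energy_ge0.
have XP k : (1 <= k <= N)%N -> fine (slab_energy Om t U k) <= X.
  move=> kN; apply: fine_le; rewrite ?fin// hmax.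
  by apply: le_bigmax_seq => //; rewrite mem_index_iota ltnS.
have pm2 : 2 <= (pt m)%:R :> R by rewrite ler_nat hpt.
have mu0 : 0 < mu_m by rewrite hmu_m; exact: stability_constant_gt0.
have tm_lt := grid_lt ht hm.
have tm0 : 0 < t m.
  by apply: le_lt_trans tm_lt; exact: (grid_ge0 ht (pred_leN hm)).
(* With this Young parameter the test functions cost dl * t m * X = mu_m * X,
   at most one half of what the last slab gains. *)
pose dl := mu_m / t m.
have dl0 : 0 < dl by rewrite divr_gt0.
have [Q [XQ main]] := stability_sum oOm VL VS ht hpt hf hU Vu1h dl0 XP hm.
have mN : (m <= N)%N by case/andP: hm.
have force := sum_slab_force oOm ht hf mN.
have init : node_energy Om t U 0 u1h <=
    1 / 2 * (h1seminorm Om u0 ^+ 2 + l2norm Om u1 ^+ 2).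
  rewrite /node_energy mul1r ler_wpM2l// addrC; apply: lerD.
    rewrite /h1seminorm sqr_sqrtr; last exact: (psd_ge0 PA).
    have [[_ _ U0 _] _] := hU; have [-> _ _] := ht; rewrite U0.
    apply: (psd_projection_le L PA) => //; last exact: e0.
    - exact: sobolev10_l2pair.
    - exact: VS.
  rewrite /l2norm sqr_sqrtr; last exact: ip_ge0.
  pose u1p : h1fun R d := (u1, fun=> 0).
  have Lu1 : l2pair Om u1p.
    split=> // i; rewrite (_ : (fun _ => _) = fun=> 0) /=.
      exact: square_integrable0.
    by apply/funext => x; rewrite mxE.
  apply: (psd_projection_le L PG Lu1); first exact: VS.
  exact: e1.
have energy : 2 * mu_m * X <= (48 * (pt m)%:R * (t m - t m.-1))^-1 * Q.
  rewrite hmu_m; apply: stability_constant_le X0 _ => //; first by rewrite subr_gt0.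
  by rewrite natr1.
rewrite XE -EFinM -!EFinD lee_fin.
have e2 : dl * (X * t m) = mu_m * X by rewrite /dl; field; rewrite gt_eqF.
have e3 : (4 * dl)^-1 * (\sum_(1 <= k < m.+1) slab_force Om t f k) <=
    t m / mu_m * bochner_norm Om `]0, t m[ f ^+ 2.
  have -> : (4 * dl)^-1 = 4^-1 * (t m / mu_m).
    by rewrite /dl; field; rewrite !gt_eqF.
  have B0 : 0 <= bochner_norm Om `]0, t m[ f ^+ 2 by exact: sqr_ge0.
  have c0 : 0 <= t m / mu_m by rewrite divr_ge0// ltW.
  have := ler_wpM2l c0 force.
  have : 0 <= t m / mu_m * bochner_norm Om `]0, t m[ f ^+ 2 by exact: mulr_ge0.
  set S := \sum_(_ <= _ < _) _.
  have S0 : 0 <= t m / mu_m * S.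
    apply: mulr_ge0 => //; apply: sumr_ge0 => k _.
    by apply: Rintegral_ge0 => s _; exact: sqr_ge0.
  by rewrite -[4^-1 * _ * _]mulrA; lra.
move: main; rewrite e2 => main.
by rewrite !mul1r in init *; lra.
Qed.
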